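(* Let $k$ be a field, $a,b\ge 2$ integers, $q\in k$ a nonzero element which is not a root of unity, and $A = k\langle X,Y\rangle/(X^a,\,XY-qYX,\,Y^b)$. Then the Hochschild cohomology of $A$ is given by $$\dim_k \mathrm{HH}^n(A)=\begin{cases} 2 & \text{for } n=0,\\ 2 & \text{for } n=1,\\ 1 & \text{for } n=2,\\ 0 & \text{for } n\ge 3.\end{cases}$$ In particular, the Hochschild cohomology of $A$ vanishes in high degrees.
   Context: For a finite dimensional $k$-algebra $A$ with enveloping algebra $A^{e}=A\otimes_k A^{op}$, the Hochschild cohomology is $\mathrm{HH}^n(A)=\operatorname{Ext}_{A^{e}}^n(A,A)$. *)

(* Defs.v *)
From HB Require Import structures.
From mathcomp Require Import all_boot all_algebra finmap.
From mathcomp Require Import boolp functions.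
From mathcomp Require Import monalg.

Set Implicit Arguments.
Unset Strict Implicit.
Unset Printing Implicit Defensive.

Import GRing.Theory.
Local Open Scope ring_scope.

Record submodule (R : pzRingType) (V : lmodType R) := Submodule {
  submod_pred :> {pred V};
  submodP : submod_closed submod_pred }.

HB.instance Definition _ (R : pzRingType) (V : lmodType R) (S : submodule V) :=
  GRing.isZmodClosed.Build V (submod_pred S) (GRing.submod_closedB (submodP S)).

Lemma submodZ (R : pzRingType) (V : lmodType R) (S : submodule V) c v :
  v \in S -> c *: v \in S.
Proof.
by move=> vS; have [S0 Slin] := submodP S; rewrite -[_ *: _]addr0 Slin.
Qed.

Section SubmoduleType.
Variables (R : pzRingType) (V : lmodType R) (S : submodule V).

Record submod_type := SubmodType {
  submod_val :> V;
  submod_valP : submod_val \in S }.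

HB.instance Definition _ := [isSub for submod_val].
HB.instance Definition _ := [Choice of submod_type by <:].
HB.instance Definition _ :=
  GRing.SubChoice_isSubLmodule.Build R V (fun v => v \in S) submod_type
    (GRing.submod_closed_semi (submodP S)).

End SubmoduleType.

Section GeneratedSubmodule.
Variables (R : pzRingType) (V : lmodType R) (G : V -> Prop).

Definition span_pred : {pred V} :=
  fun v => `[< forall S : submodule V, (forall g, G g -> g \in S) -> v \in S >].

Lemma span_closed : submod_closed span_pred.
Proof.
split; first by apply/asboolP => S _; exact: rpred0.
move=> c u v /asboolP uS /asboolP vS; apply/asboolP => S GS.
by rewrite rpredD ?submodZ ?uS ?vS.
Qed.

Definition span : submodule V := Submodule span_closed.

End GeneratedSubmodule.

Section QuotientModule.
Variables (R : pzRingType) (V : lmodType R) (S : submodule V).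

Definition quotmod := Quotient.quot S.

HB.instance Definition _ := GRing.Zmodule.on quotmod.

Definition quot_pi (v : V) : quotmod := (\pi_(Quotient.quot S) v)%qT.
Definition quot_repr (x : quotmod) : V := generic_quotient.repr x.

Lemma quot_reprK : cancel quot_repr quot_pi.
Proof. exact: generic_quotient.reprK. Qed.

Lemma quot_eqP u v : reflect (quot_pi u = quot_pi v) (u - v \in S).
Proof. by rewrite Quotient.idealrBE; exact: eqP. Qed.

Lemma quot_pi_zmod_morphism : zmod_morphism quot_pi.
Proof. by move=> u v; rewrite /quot_pi raddfB. Qed.

HB.instance Definition _ :=
  GRing.isZmodMorphism.Build V quotmod quot_pi quot_pi_zmod_morphism.

Definition quot_scale (c : R) (x : quotmod) : quotmod :=
  quot_pi (c *: quot_repr x).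

Lemma quot_scaleE c v : quot_scale c (quot_pi v) = quot_pi (c *: v).
Proof.
by apply/quot_eqP; rewrite -scalerBr submodZ //; apply/quot_eqP/quot_reprK.
Qed.

Lemma quot_scaleA a b x :
  quot_scale a (quot_scale b x) = quot_scale (a * b) x.
Proof. by rewrite -[x]quot_reprK !quot_scaleE scalerA. Qed.

Lemma quot_scale1 : left_id 1 quot_scale.
Proof. by move=> x; rewrite -[x]quot_reprK !quot_scaleE scale1r. Qed.

Lemma quot_scaleDr : right_distributive quot_scale +%R.
Proof.
move=> c x y; rewrite -[x]quot_reprK -[y]quot_reprK -raddfD !quot_scaleE.
by rewrite -raddfD scalerDr.
Qed.

Lemma quot_scaleDl x : {morph quot_scale^~ x : a b / a + b}.
Proof.
by move=> a b /=; rewrite -[x]quot_reprK !quot_scaleE scalerDl raddfD.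
Qed.

HB.instance Definition _ := GRing.Zmodule_isLmodule.Build R quotmod
  quot_scaleA quot_scale1 quot_scaleDr quot_scaleDl.

Lemma quot_pi_scalable : scalable quot_pi.
Proof. by move=> c v; rewrite -quot_scaleE. Qed.

HB.instance Definition _ :=
  GRing.isScalable.Build R V quotmod *:%R quot_pi quot_pi_scalable.

End QuotientModule.

Section LinearLift.
Variables (R : pzRingType) (V W : lmodType R) (S : submodule V).
Variable f : {linear V -> W}.

Definition quot_lift (x : quotmod S) : W := f (quot_repr x).

Hypothesis fS : forall v, v \in S -> f v = 0.

Lemma quot_liftE v : quot_lift (quot_pi S v) = f v.
Proof.
apply/subr0_eq; rewrite -linearB; apply/fS.
by apply/quot_eqP/quot_reprK.
Qed.

Lemma quot_lift_linear : linear quot_lift.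
Proof.
move=> c x y; rewrite -[x]quot_reprK -[y]quot_reprK -linearP !quot_liftE.
by rewrite linearP.
Qed.

End LinearLift.

Record ideal (k : comNzRingType) (A : algType k) := Ideal {
  ideal_submod :> submodule A;
  idealMl : forall x s, s \in ideal_submod -> x * s \in ideal_submod;
  idealMr : forall x s, s \in ideal_submod -> s * x \in ideal_submod;
  ideal_proper : 1 \notin ideal_submod }.

Section GeneratedIdeal.
Variables (k : comNzRingType) (A : algType k) (G : A -> Prop).

Definition gen_pred : {pred A} := fun v =>
  `[< forall S : submodule A,
        (forall x s, s \in S -> x * s \in S) ->
        (forall x s, s \in S -> s * x \in S) ->
        (forall g, G g -> g \in S) -> v \in S >].

Lemma gen_closed : submod_closed gen_pred.
Proof.
split; first by apply/asboolP => S _ _ _; exact: rpred0.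
move=> c u v /asboolP uS /asboolP vS; apply/asboolP => S Sl Sr GS.
by rewrite rpredD ?submodZ ?uS ?vS.
Qed.

Definition gen_submod : submodule A := Submodule gen_closed.

Lemma gen_Ml x s : s \in gen_submod -> x * s \in gen_submod.
Proof.
by move=> /asboolP sS; apply/asboolP => S Sl Sr GS; apply/Sl/sS.
Qed.

Lemma gen_Mr x s : s \in gen_submod -> s * x \in gen_submod.
Proof.
by move=> /asboolP sS; apply/asboolP => S Sl Sr GS; apply/Sr/sS.
Qed.

Hypothesis gen_proper : 1 \notin gen_submod.

Definition gen_ideal : ideal A := Ideal gen_Ml gen_Mr gen_proper.

End GeneratedIdeal.

Section QuotientAlgebra.
Variables (k : comNzRingType) (A : algType k) (I : ideal A).

Definition quotalg := quotmod I.

HB.instance Definition _ := GRing.Lmodule.on quotalg.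

Local Notation pi := (quot_pi I : A -> quotalg).
Local Notation repr := (@quot_repr k A I : quotalg -> A).

Definition quot_mul (x y : quotalg) : quotalg := pi (repr x * repr y).

Lemma quot_mulE u v : quot_mul (pi u) (pi v) = pi (u * v).
Proof.
apply: (elimT (quot_eqP I _ _)).
have E w : repr (pi w) - w \in I by apply/quot_eqP/quot_reprK.
rewrite -[X in X - _](addrNK (u * repr (pi v))) -mulrBl -addrA -mulrBr.
by rewrite rpredD //; [apply: idealMr | apply: idealMl]; exact: E.
Qed.

Lemma quot_mulA : associative quot_mul.
Proof.
move=> x y z; rewrite -[x]quot_reprK -[y]quot_reprK -[z]quot_reprK.
by rewrite !quot_mulE mulrA.
Qed.

Lemma quot_mul1 : left_id (pi 1) quot_mul.
Proof. by move=> x; rewrite -[x]quot_reprK quot_mulE mul1r. Qed.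

Lemma quot_1mul : right_id (pi 1) quot_mul.
Proof. by move=> x; rewrite -[x]quot_reprK quot_mulE mulr1. Qed.

Lemma quot_mulDl : left_distributive quot_mul +%R.
Proof.
move=> x y z; rewrite -[x]quot_reprK -[y]quot_reprK -[z]quot_reprK.
by rewrite -raddfD !quot_mulE mulrDl raddfD.
Qed.

Lemma quot_mulDr : right_distributive quot_mul +%R.
Proof.
move=> x y z; rewrite -[x]quot_reprK -[y]quot_reprK -[z]quot_reprK.
by rewrite -raddfD !quot_mulE mulrDr raddfD.
Qed.

Lemma quot_1neq0 : pi 1 != 0.
Proof.
apply/eqP => pi10; have := ideal_proper I.
by rewrite -[1]subr0; case/negP; apply/quot_eqP; rewrite raddf0.
Qed.

HB.instance Definition _ := GRing.Zmodule_isNzRing.Build quotalg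
  quot_mulA quot_mul1 quot_1mul quot_mulDl quot_mulDr quot_1neq0.

Lemma quotalg_scaleE (c : k) u : c *: pi u = pi (c *: u).
Proof. exact: quot_scaleE. Qed.

Lemma quotalg_mulE u v : pi u * pi v = pi (u * v).
Proof. exact: quot_mulE. Qed.

Lemma quot_scaleAl (c : k) (x y : quotalg) : c *: (x * y) = (c *: x) * y.
Proof.
rewrite -[x]quot_reprK -[y]quot_reprK.
by rewrite quotalg_mulE !quotalg_scaleE quotalg_mulE scalerAl.
Qed.

HB.instance Definition _ :=
  GRing.Lmodule_isLalgebra.Build k quotalg quot_scaleAl.

Lemma quot_scaleAr (c : k) (x y : quotalg) : c *: (x * y) = x * (c *: y).
Proof.
rewrite -[x]quot_reprK -[y]quot_reprK.
by rewrite quotalg_mulE !quotalg_scaleE quotalg_mulE scalerAr.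
Qed.

HB.instance Definition _ :=
  GRing.Lalgebra_isAlgebra.Build k quotalg quot_scaleAr.

Definition quotalg_pi : A -> quotalg := pi.

HB.instance Definition _ := GRing.Linear.on quotalg_pi.

Lemma quotalg_pi_monoid_morphism : monoid_morphism quotalg_pi.
Proof. by split=> // u v; rewrite /quotalg_pi -quotalg_mulE. Qed.

HB.instance Definition _ :=
  GRing.isMonoidMorphism.Build A quotalg quotalg_pi quotalg_pi_monoid_morphism.

End QuotientAlgebra.

(* An alias of the monoid algebra of words, on which the algType structure    *)
(* (absent from monalg for non-commutative monoids) is declared.              *)
Definition free_alg (k : comNzRingType) (I : choiceType) : Type :=
  {malg k[{fmonom I}]}.

Section FreeAlgebra.
Variables (k : comNzRingType) (I : choiceType).

HB.instance Definition _ :=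
  GRing.Lalgebra.copy (free_alg k I) {malg k[{fmonom I}]}.

Lemma free_alg_scaleAr (c : k) (x y : free_alg k I) :
  c *: (x * y) = x * (c *: y).
Proof.
pose M : nzRingType := {malg k[{fmonom I}]}.
have comm_c : (c%:MP : M) * (x : M) = (x : M) * c%:MP.
  rewrite [LHS]fgmulUg [RHS]fgmulgU; apply: eq_bigr => m _.
  by rewrite mulrC mul1m mulm1.
have -> : c *: (x * y) = (c%:MP : M) * ((x : M) * (y : M)).
  by rewrite mul_malgC.
rewrite mulrA comm_c -mulrA.
by congr (_ * _); rewrite mul_malgC.
Qed.

HB.instance Definition _ :=
  GRing.Lalgebra_isAlgebra.Build k (free_alg k I) free_alg_scaleAr.

Definition free_gen (i : I) : free_alg k I := << fmu i >>.

End FreeAlgebra.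

Section QuantumCompleteIntersection.
Variables (k : fieldType) (q : k) (a b : nat).

Local Notation F := (free_alg k 'I_2).
Local Notation fX := (free_gen k (ord0 : 'I_2)).
Local Notation fY := (free_gen k (ord_max : 'I_2)).

Inductive qci_rel : F -> Prop :=
| QciX : qci_rel (fX ^+ a)
| QciXY : qci_rel (fX * fY - q *: (fY * fX))
| QciY : qci_rel (fY ^+ b).

Lemma qci_proper :
  (2 <= a)%N -> (2 <= b)%N -> 1 \notin gen_submod qci_rel.
Proof.
move=> a2 b2.
pose M : nzRingType := {malg k[{fmonom 'I_2}]}.
pose eps : F -> k := fun g => mcoeff (mone : {fmonom 'I_2}) g.
have epsM x y : eps (x * y) = eps x * eps y by exact: (rmorphM (mcoeff _)).
have eps1 : eps 1 = 1 by exact: (rmorph1 (mcoeff _)).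
have epsX x n : eps (x ^+ n) = eps x ^+ n.
  by elim: n => [|n IHn]; rewrite ?expr0 // !exprS epsM IHn.
have epsP c x y : eps (c *: x + y) = c * eps x + eps y.
  by rewrite [LHS]mcoeffD mcoeffZ.
have eps0 i : eps (free_gen k i) = 0.
  by rewrite [LHS]mcoeffU fmP fm1 fmU.
have kerP : submod_closed (fun x : F => eps x == 0).
  split=> [|c x y /eqP x0 /eqP y0]; first by apply/eqP/mcoeff0.
  by apply/eqP; rewrite epsP x0 y0 mulr0 addr0.
apply/negP => /asboolP /(_ (Submodule kerP)) H.
suff : eps 1 == 0 by rewrite eps1 oner_eq0.
apply: H => [x s /eqP s0|x s /eqP s0|_ []]; apply/eqP.
- by rewrite epsM s0 mulr0.
- by rewrite epsM s0 mul0r.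
- by rewrite epsX eps0 expr0n; case: (a) a2.
- by rewrite addrC -scaleNr epsP !epsM !eps0 !mulr0 addr0.
- by rewrite epsX eps0 expr0n; case: (b) b2.
Qed.

Definition qci (a2 : (2 <= a)%N) (b2 : (2 <= b)%N) : algType k :=
  quotalg (gen_ideal (qci_proper a2 b2)).

End QuantumCompleteIntersection.

Section Tensor.
Variables (k : comNzRingType) (U V : lmodType k).

Local Notation F := {malg k[(U * V)%type]}.

Inductive tensor_rel : F -> Prop :=
| TensorDl u u' v :
    tensor_rel (<< (u + u', v) >> - << (u, v) >> - << (u', v) >>)
| TensorZl c u v : tensor_rel (<< (c *: u, v) >> - c *: << (u, v) >>)
| TensorDr u v v' :
    tensor_rel (<< (u, v + v') >> - << (u, v) >> - << (u, v') >>)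
| TensorZr c u v : tensor_rel (<< (u, c *: v) >> - c *: << (u, v) >>).

Definition tensor := quotmod (span tensor_rel).

HB.instance Definition _ := GRing.Lmodule.on tensor.

Definition tens (u : U) (v : V) : tensor := quot_pi _ << (u, v) >>.

Definition bilin (W : lmodType k) (f : U -> V -> W) :=
  (forall v, linear (f^~ v)) /\ (forall u, linear (f u)).

Lemma tens_bilin : bilin tens.
Proof.
have rel_eq x y : tensor_rel (x - y) ->
    quot_pi (span tensor_rel) x = quot_pi _ y.
  by move=> r; apply/quot_eqP/asboolP => S; apply.
have piP c x y : c *: (quot_pi _ x : tensor) + (quot_pi _ y : tensor)
                   = quot_pi (span tensor_rel) (c *: x + y).
  by rewrite [RHS]linearP.
split=> [v c u u'|u c v v']; rewrite /tens piP.
  transitivity (quot_pi (span tensor_rel)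
    (<< (c *: u, v) >> + << (u', v) >>)).
    by apply: rel_eq; rewrite opprD addrA; exact: TensorDl.
  by rewrite !raddfD /=; congr (_ + _); apply: rel_eq; exact: TensorZl.
transitivity (quot_pi (span tensor_rel)
  (<< (u, c *: v) >> + << (u, v') >>)).
  by apply: rel_eq; rewrite opprD addrA; exact: TensorDr.
by rewrite !raddfD /=; congr (_ + _); apply: rel_eq; exact: TensorZr.
Qed.

Section Lift.
Variables (W : lmodType k) (f : U -> V -> W).

Definition free_lift (g : F) : W :=
  \sum_(p <- msupp g) g@_p *: f p.1 p.2.

Lemma free_liftEw (d : {fset (U * V)%type}) (g : F) : (msupp g `<=` d)%fset ->
  free_lift g = \sum_(p <- d) g@_p *: f p.1 p.2.
Proof.
move=> le; rewrite [LHS](big_fset_incl _ le) => //= x xd /mcoeff_outdom ->.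
by rewrite scale0r.
Qed.

Lemma free_lift_linear : linear free_lift.
Proof.
move=> c x y; pose d := (msupp x `|` msupp y)%fset.
have lex : (msupp x `<=` d)%fset by exact: fsubsetUl.
have ley : (msupp y `<=` d)%fset by exact: fsubsetUr.
have lexy : (msupp (c *: x + y) `<=` d)%fset.
  apply: fsubset_trans (msuppD_le _ _) _; apply: fsetSU; exact: msuppZ_le.
rewrite (free_liftEw lex) (free_liftEw ley) (free_liftEw lexy).
rewrite scaler_sumr -big_split /=; apply: eq_bigr => p _.
by rewrite mcoeffD mcoeffZ scalerDl scalerA.
Qed.

HB.instance Definition _ :=
  GRing.isLinear.Build k F W *:%R free_lift free_lift_linear.

Lemma free_liftU u v : free_lift << (u, v) >> = f u v.
Proof.
by rewrite (free_liftEw (msuppU_le (x := 1))) big_seq_fset1 mcoeffUU scale1r.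
Qed.

Definition tensor_lift (x : tensor) : W := quot_lift free_lift x.

Hypothesis f_bilin : bilin f.

Lemma free_lift_rel v : v \in span tensor_rel -> free_lift v = 0.
Proof.
have kerP : submod_closed (fun x : F => free_lift x == 0).
  split=> [|c x y /eqP x0 /eqP y0]; first by apply/eqP/raddf0.
  by apply/eqP; rewrite free_lift_linear x0 y0 scaler0 addr0.
have [fl fr] := f_bilin.
have fDl v' : {morph f^~ v' : x y / x + y}.
  by move=> x y; have := fl v' 1 x y; rewrite !scale1r.
have fDr u' : {morph f u' : x y / x + y}.
  by move=> x y; have := fr u' 1 x y; rewrite !scale1r.
have fZl c u' v' : f (c *: u') v' = c *: f u' v'.
  have f0 : f 0 v' = 0.
    by apply: (addrI (f 0 v')); rewrite -[LHS]fDl !addr0.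
  by have := fl v' c u' 0; rewrite f0 !addr0.
have fZr c u' v' : f u' (c *: v') = c *: f u' v'.
  have f0 : f u' 0 = 0.
    by apply: (addrI (f u' 0)); rewrite -fDr !addr0.
  by have := fr u' c v' 0; rewrite f0 !addr0.
have LB x y : free_lift (x - y) = free_lift x - free_lift y.
  exact: linearB.
have LZ c x : free_lift (c *: x) = c *: free_lift x by exact: linearZ.
move=> /asboolP /(_ (Submodule kerP)) H; apply/eqP/H => _ [].
- move=> u1 u2 v'; apply/eqP.
  by rewrite !LB !free_liftU [f (_ + _) _]fDl -addrA -opprD subrr.
- by move=> c u' v'; apply/eqP; rewrite LB LZ !free_liftU fZl subrr.
- move=> u' v1 v2; apply/eqP.
  by rewrite !LB !free_liftU fDr -addrA -opprD subrr.
- by move=> c u' v'; apply/eqP; rewrite LB LZ !free_liftU fZr subrr.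
Qed.

Lemma tensor_liftE u v : tensor_lift (tens u v) = f u v.
Proof.
rewrite /tensor_lift /tens quot_liftE; last by move=> w /free_lift_rel.
exact: free_liftU.
Qed.

Lemma tensor_lift_linear : linear tensor_lift.
Proof. exact: (quot_lift_linear free_lift_rel). Qed.

End Lift.

Lemma tensor_sum (x : tensor) :
  exists s : seq (U * V), x = \sum_(p <- s) tens p.1 p.2.
Proof.
have [tl _] := tens_bilin.
have E : x = quot_pi _ (quot_repr x) by rewrite quot_reprK.
rewrite E (monalgE (quot_repr x)) raddf_sum /=.
exists [seq ((quot_repr x)@_p *: p.1, p.2) | p <- msupp (quot_repr x)].
rewrite big_map /=; apply: eq_bigr => -[u v] _ /=.
set c := _@_ _.
have -> : << c *g (u, v) >> = c *: << (u, v) >> :> F.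
  by apply/malgP => p; rewrite mcoeffZ !mcoeffU mulr_natr.
have t0 : tens 0 v = 0.
  apply: (addrI (tens 0 v)).
  by have := tl v 1 0 0; rewrite !scale1r !addr0 => <-.
have := tl v c u 0; rewrite addr0 t0 addr0 => ->.
by rewrite linearZ.
Qed.

Lemma tensor_ext (W : lmodType k) (f g : tensor -> W) :
  linear f -> linear g -> (forall u v, f (tens u v) = g (tens u v)) -> f =1 g.
Proof.
move=> fl gl fg x; have [s ->] := tensor_sum x.
have add0 (h : tensor -> W) : linear h -> h 0 = 0.
  move=> hl; apply: (addrI (h 0)).
  by have := hl 1 0 0; rewrite !scale1r !addr0 => <-.
have addD (h : tensor -> W) : linear h -> {morph h : y z / y + z}.
  by move=> hl y z; have := hl 1 y z; rewrite !scale1r.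
rewrite (big_morph f (addD f fl) (add0 f fl)).
rewrite (big_morph g (addD g gl) (add0 g gl)).
by apply: eq_bigr => p _; exact: fg.
Qed.

End Tensor.

Lemma tensor_lift_lin (k : comNzRingType) (U V W : lmodType k) (c : k)
    (f g h : U -> V -> W) (x : tensor U V) :
    (forall u v, h u v = c *: f u v + g u v) ->
  tensor_lift h x = c *: tensor_lift f x + tensor_lift g x.
Proof.
move=> hE; rewrite /tensor_lift /quot_lift /= /free_lift scaler_sumr -big_split.
by apply: eq_bigr => p _ /=; rewrite hE scalerDr !scalerA mulrC.
Qed.

Section Enveloping.
Variables (k : comNzRingType) (A : algType k).

(* The opposite algebra has the same underlying k-module as A, so that the    *)
(* carrier of the enveloping algebra is the tensor product of A with A; the   *)
(* second factor is multiplied in the reverse order.                          *)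
Definition env : Type := tensor A A.

HB.instance Definition _ := GRing.Lmodule.on env.

Definition env_tens (a b : A) : env := tens a b.

Definition env_mul (x y : env) : env :=
  tensor_lift (fun a b =>
    tensor_lift (fun a' b' => env_tens (a * a') (b' * b)) y) x.

Definition env_one : env := env_tens 1 1.

Let tlin (b : A) c a a' :
  env_tens (c *: a + a') b = c *: env_tens a b + env_tens a' b.
Proof. exact: (tens_bilin A A).1. Qed.

Let trin (a : A) c b b' :
  env_tens a (c *: b + b') = c *: env_tens a b + env_tens a b'.
Proof. exact: (tens_bilin A A).2. Qed.

Let inner_bilin (a b : A) :
  bilin (fun a' b' : A => env_tens (a * a') (b' * b)).
Proof.
split=> [v c u u'|u c v v'] /=; first by rewrite mulrDr -scalerAr tlin.
by rewrite mulrDl -scalerAl trin.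
Qed.

Let outer_bilin (y : env) : bilin (fun a b =>
  tensor_lift (fun a' b' : A => env_tens (a * a') (b' * b)) y).
Proof.
split=> [v c u u'|u c v v'] /=; apply: tensor_lift_lin => a' b'.
  by rewrite mulrDl -scalerAl tlin.
by rewrite mulrDr -scalerAr trin.
Qed.

Lemma env_mulE a b a' b' :
  env_mul (env_tens a b) (env_tens a' b') = env_tens (a * a') (b' * b).
Proof.
by rewrite /env_mul (tensor_liftE (outer_bilin _)) (tensor_liftE (inner_bilin _ _)).
Qed.

Lemma env_mul_linl y : linear (env_mul^~ y).
Proof. exact: (tensor_lift_linear (outer_bilin y)). Qed.

Lemma env_mul_linr x : linear (env_mul x).
Proof.
move=> c y y'; apply: tensor_lift_lin => a b.
exact: (tensor_lift_linear (inner_bilin a b)).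
Qed.

Lemma env_mulA : associative env_mul.
Proof.
move=> x y z; move: x; apply: tensor_ext.
- by move=> c x x'; rewrite env_mul_linl.
- by move=> c x x'; rewrite !env_mul_linl.
move=> a b; move: y; apply: tensor_ext.
- by move=> c y y'; rewrite env_mul_linl env_mul_linr.
- by move=> c y y'; rewrite env_mul_linr env_mul_linl.
move=> a' b'; move: z; apply: tensor_ext.
- by move=> c z z'; rewrite !env_mul_linr.
- by move=> c z z'; rewrite env_mul_linr.
by move=> a'' b''; rewrite -!/(env_tens _ _) !env_mulE !mulrA.
Qed.

Lemma env_mul1 : left_id env_one env_mul.
Proof.
apply: tensor_ext => [c x x'|//|a b]; first by rewrite env_mul_linr.
by rewrite -/(env_tens _ _) env_mulE mul1r mulr1.
Qed.

Lemma env_1mul : right_id env_one env_mul.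
Proof.
apply: tensor_ext => [c x x'|//|a b]; first by rewrite env_mul_linl.
by rewrite -/(env_tens _ _) env_mulE mul1r mulr1.
Qed.

Lemma env_mulDl : left_distributive env_mul +%R.
Proof. by move=> x y z; have := env_mul_linl z 1 x y; rewrite !scale1r. Qed.

Lemma env_mulDr : right_distributive env_mul +%R.
Proof. by move=> x y z; have := env_mul_linr x 1 y z; rewrite !scale1r. Qed.

Definition env_act (x : env) (m : A) : A :=
  tensor_lift (fun a b => a * m * b) x.

Let act_bilin (m : A) : bilin (fun a b : A => a * m * b).
Proof.
split=> [v c u u'|u c v v'] /=; first by rewrite !mulrDl -!scalerAl.
by rewrite mulrDr -scalerAr.
Qed.

Lemma env_actE a b m : env_act (env_tens a b) m = a * m * b.
Proof. by rewrite /env_act (tensor_liftE (act_bilin m)). Qed.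

Lemma env_act_linl m : linear (env_act^~ m).
Proof. exact: (tensor_lift_linear (act_bilin m)). Qed.

Lemma env_act_linr x : linear (env_act x).
Proof.
move=> c m m'; apply: tensor_lift_lin => a b.
by rewrite mulrDr mulrDl -scalerAr -scalerAl.
Qed.

Lemma env_1neq0 : env_one != 0.
Proof.
apply/eqP => /(congr1 (env_act^~ 1)) /=; rewrite env_actE !mulr1.
have -> : env_act 0 1 = 0.
  apply: (addrI (env_act 0 1)).
  by have := env_act_linl 1 1 0 0; rewrite !scale1r !addr0 => <-.
by apply/eqP; exact: oner_neq0.
Qed.

HB.instance Definition _ := GRing.Zmodule_isNzRing.Build env
  env_mulA env_mul1 env_1mul env_mulDl env_mulDr env_1neq0.

Lemma env_scaleAl (c : k) (x y : env) : c *: (x * y) = (c *: x) * y.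
Proof.
have y0 : env_mul 0 y = 0 by exact: mul0r.
by have := env_mul_linl y c x 0; rewrite /= addr0 y0 addr0 => /esym.
Qed.

HB.instance Definition _ := GRing.Lmodule_isLalgebra.Build k env env_scaleAl.

Lemma env_scaleAr (c : k) (x y : env) : c *: (x * y) = x * (c *: y).
Proof.
have x0 : env_mul x 0 = 0 by exact: mulr0.
by have := env_mul_linr x c y 0; rewrite addr0 x0 addr0 => /esym.
Qed.

HB.instance Definition _ := GRing.Lalgebra_isAlgebra.Build k env env_scaleAr.

Definition bimod : Type := A.

HB.instance Definition _ := GRing.Zmodule.on bimod.

Lemma env_actA (x y : env) (m : bimod) :
  env_act x (env_act y m) = env_act (x * y) m.
Proof.
move: x; apply: tensor_ext.
- by move=> c x x'; rewrite env_act_linl.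
- by move=> c x x'; rewrite [_ * y]env_mul_linl env_act_linl.
move=> a b; move: y; apply: tensor_ext.
- by move=> c y y'; rewrite env_act_linl env_act_linr.
- by move=> c y y'; rewrite [_ * _]env_mul_linr env_act_linl.
move=> a' b'; rewrite -!/(env_tens _ _) [_ * _]env_mulE !env_actE.
by rewrite !mulrA.
Qed.

Lemma env_act1 : left_id (1 : env) (env_act : env -> bimod -> bimod).
Proof. by move=> m; rewrite env_actE mul1r mulr1. Qed.

Lemma env_actDr : right_distributive (env_act : env -> bimod -> bimod) +%R.
Proof. by move=> x m m'; have := env_act_linr x 1 m m'; rewrite !scale1r. Qed.

Lemma env_actDl (m : bimod) : {morph (env_act^~ m : env -> bimod) : x y / x + y}.
Proof. by move=> x y; have := env_act_linl m 1 x y; rewrite !scale1r. Qed.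

HB.instance Definition _ := GRing.Zmodule_isLmodule.Build env bimod
  env_actA env_act1 env_actDr env_actDl.

Lemma env_scaleE a b (m : bimod) :
  env_tens a b *: m = ((a : A) * (m : A) * (b : A) : A).
Proof. exact: env_actE. Qed.

End Enveloping.

Definition projective (R : pzRingType) (P : lmodType R) : Prop :=
  forall (M N : lmodType R) (f : {linear M -> N}) (g : {linear P -> N}),
    (forall y, exists x, f x = y) ->
    exists h : {linear P -> M}, forall x, f (h x) = g x.

Record proj_resolution (R : pzRingType) (M : lmodType R) := ProjResolution {
  res_obj : nat -> lmodType R;
  res_diff : forall n, {linear res_obj n.+1 -> res_obj n};
  res_aug : {linear res_obj 0 -> M};
  res_proj : forall n, projective (res_obj n);
  res_aug_surj : forall m, exists x, res_aug x = m;
  res_exact0 : forall x, res_aug x = 0 <-> exists y, res_diff 0 y = x;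
  res_exactS : forall n x,
    res_diff n x = 0 <-> exists y, res_diff n.+1 y = x }.

Section Restriction.
Variables (k : comNzRingType) (R : algType k) (N : lmodType R).

Definition restr : Type := N.

HB.instance Definition _ := GRing.Zmodule.on restr.

Definition restr_scale (c : k) (x : restr) : restr := c%:A *: (x : N).

Lemma restr_scaleA c d x :
  restr_scale c (restr_scale d x) = restr_scale (c * d) x.
Proof. by rewrite /restr_scale scalerA mulr_algl scalerA. Qed.

Lemma restr_scale1 : left_id 1 restr_scale.
Proof. by move=> x; rewrite /restr_scale !scale1r. Qed.

Lemma restr_scaleDr : right_distributive restr_scale +%R.
Proof. by move=> c x y; rewrite /restr_scale scalerDr. Qed.

Lemma restr_scaleDl x : {morph restr_scale^~ x : c d / c + d}.
Proof. by move=> c d; rewrite /restr_scale !scalerDl. Qed.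

HB.instance Definition _ := GRing.Zmodule_isLmodule.Build k restr
  restr_scaleA restr_scale1 restr_scaleDr restr_scaleDl.

End Restriction.

Section Hom.
Variables (k : comNzRingType) (R : algType k) (M N : lmodType R).

Definition hom_pred : {pred M -> restr N} :=
  fun f => `[< linear (f : M -> N) >].

Lemma hom_closed : submod_closed hom_pred.
Proof.
split; first by apply/asboolP => r x y; rewrite scaler0 addr0.
move=> c f g /asboolP fl /asboolP gl; apply/asboolP => r x y.
have E z : (c *: f + g) z = (c%:A *: (f z : N) + g z : N) by [].
rewrite !E fl gl !scalerDr !scalerA mulr_algl mulr_algr.
by rewrite -!addrA; congr (_ + _); rewrite addrCA.
Qed.

Definition hom_submod : submodule (M -> restr N) := Submodule hom_closed.

Definition hom : Type := submod_type hom_submod.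

HB.instance Definition _ := GRing.Lmodule.on hom.

Definition hom_fun (f : hom) : M -> N := submod_val f.

Lemma hom_fun_linear (f : hom) : linear (hom_fun f).
Proof. by have /asboolP := submod_valP f. Qed.

HB.instance Definition _ (f : hom) :=
  GRing.isLinear.Build R M N *:%R (hom_fun f) (hom_fun_linear f).

Lemma linear_homP (f : {linear M -> N}) : (f : M -> restr N) \in hom_submod.
Proof. by apply/asboolP => r x y; rewrite linearP. Qed.

Definition to_hom (f : {linear M -> N}) : hom := SubmodType (linear_homP f).

Lemma homP (f g : hom) : hom_fun f =1 hom_fun g -> f = g.
Proof. by move=> fg; apply: val_inj; apply: funext. Qed.

End Hom.

Section Precomposition.
Variables (k : comNzRingType) (R : algType k) (M M' N : lmodType R).
Variable d : {linear M' -> M}.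

Definition precomp (f : hom M N) : hom M' N := to_hom (hom_fun f \o d).

Lemma precomp_linear : linear precomp.
Proof. by move=> c f g; apply: val_inj. Qed.

HB.instance Definition _ :=
  GRing.isLinear.Build k (hom M N) (hom M' N) *:%R precomp precomp_linear.

End Precomposition.

Section Ext.
Variables (k : comNzRingType) (R : algType k) (M N : lmodType R).
Variables (P : proj_resolution M) (n : nat).

Definition cocycle_pred : {pred hom (res_obj P n) N} :=
  fun f => precomp (res_diff P n) f == 0.

Lemma cocycle_closed : submod_closed cocycle_pred.
Proof.
split=> [|c f g /eqP f0 /eqP g0]; first by apply/eqP/raddf0.
by apply/eqP; rewrite precomp_linear f0 g0 scaler0 addr0.
Qed.

Definition cocycles : submodule (hom (res_obj P n) N) :=
  Submodule cocycle_closed.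

Definition is_coboundary : hom (res_obj P n) N -> Prop :=
  match n with
  | 0 => fun f => f = 0
  | m.+1 => fun f => exists g : hom (res_obj P m) N,
                       f = precomp (res_diff P m) g
  end.

Definition coboundary_pred : {pred submod_type cocycles} :=
  fun f => `[< is_coboundary (submod_val f) >].

Lemma coboundary_closed : submod_closed coboundary_pred.
Proof.
have [B0 Blin] : is_coboundary 0 /\ forall c f g,
    is_coboundary f -> is_coboundary g -> is_coboundary (c *: f + g).
  rewrite /is_coboundary; case: n => [|m].
    by split=> // c f g -> ->; rewrite scaler0 addr0.
  split=> [|c _ _ [f ->] [g ->]]; first by exists 0; rewrite raddf0.
  by exists (c *: f + g); rewrite precomp_linear.
split=> [|c f g /asboolP fB /asboolP gB]; apply/asboolP; first exact: B0.
exact: Blin.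
Qed.

Definition coboundaries : submodule (submod_type cocycles) :=
  Submodule coboundary_closed.

(* Ext^n_R(M, N) computed from a given projective resolution P of M; up to    *)
(* isomorphism it does not depend on P, and free_resolution below shows that  *)
(* such a P always exists.                                                    *)
Definition Ext : Type := quotmod coboundaries.

HB.instance Definition _ := GRing.Lmodule.on Ext.

End Ext.

Definition has_dim (k : fieldType) (V : lmodType k) (m : nat) : Prop :=
  exists e : 'I_m -> V, forall v : V,
    exists! c : 'rV[k]_m, v = \sum_(i < m) c 0 i *: e i.

Definition HH (k : fieldType) (A : algType k)
    (P : proj_resolution (bimod A)) (n : nat) : lmodType k :=
  Ext (bimod A) P n.

Section FreeCover.
Variables (R : nzRingType) (M : lmodType R).

Definition free_mod : lmodType R := {malg R[M]}.

Section Extend.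
Variables (N : lmodType R) (f : M -> N).

Definition free_ext (g : free_mod) : N := \sum_(m <- msupp g) g@_m *: f m.

Lemma free_extEw (d : {fset M}) (g : free_mod) : (msupp g `<=` d)%fset ->
  free_ext g = \sum_(m <- d) g@_m *: f m.
Proof.
move=> le; rewrite [LHS](big_fset_incl _ le) => //= x xd /mcoeff_outdom ->.
by rewrite scale0r.
Qed.

Lemma free_ext_linear : linear free_ext.
Proof.
move=> c x y; pose d := (msupp x `|` msupp y)%fset.
have lex : (msupp x `<=` d)%fset by exact: fsubsetUl.
have ley : (msupp y `<=` d)%fset by exact: fsubsetUr.
have lexy : (msupp (c *: x + y) `<=` d)%fset.
  apply: fsubset_trans (msuppD_le _ _) _; apply: fsetSU; exact: msuppZ_le.
rewrite (free_extEw lex) (free_extEw ley) (free_extEw lexy).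
rewrite scaler_sumr -big_split /=; apply: eq_bigr => p _.
by rewrite mcoeffD mcoeffZ scalerDl scalerA.
Qed.

HB.instance Definition _ :=
  GRing.isLinear.Build R free_mod N *:%R free_ext free_ext_linear.

Lemma free_extU m : free_ext << m >> = f m.
Proof.
by rewrite (free_extEw (msuppU_le (x := 1))) big_seq_fset1 mcoeffUU scale1r.
Qed.

End Extend.

Lemma free_modE (N : lmodType R) (g : {linear free_mod -> N}) x :
  g x = free_ext (fun m => g << m >>) x.
Proof.
have {1}-> : x = \sum_(m <- msupp x) x@_m *: << m >>.
  rewrite [LHS]monalgE; apply: eq_bigr => m _.
  by apply/malgP => p; rewrite mcoeffZ !mcoeffU mulr_natr.
by rewrite linear_sum; apply: eq_bigr => m _; rewrite linearZ.
Qed.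

Lemma free_mod_projective : projective free_mod.
Proof.
move=> X Y f g f_surj.
have [h hE] := choice (fun m => f_surj (g << m >>)).
exists (free_ext h) => x; rewrite [RHS]free_modE /= /free_ext linear_sum.
by apply: eq_bigr => m _; rewrite linearZ hE.
Qed.

Definition free_cover : {linear free_mod -> M} := free_ext id.

Lemma free_cover_surj m : exists x, free_cover x = m.
Proof. by exists << m >>; exact: free_extU. Qed.

End FreeCover.

Section Kernel.
Variables (R : nzRingType) (M N : lmodType R) (f : {linear M -> N}).

Definition ker_pred : {pred M} := fun x => f x == 0.

Lemma ker_closed : submod_closed ker_pred.
Proof.
split=> [|c x y /eqP x0 /eqP y0]; first by apply/eqP/raddf0.
by apply/eqP; rewrite linearP x0 y0 scaler0 addr0.
Qed.

Definition ker_mod : lmodType R := submod_type (Submodule ker_closed).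

Definition ker_val (x : ker_mod) : M := submod_val x.

Lemma ker_val_linear : linear ker_val. Proof. by []. Qed.

HB.instance Definition _ :=
  GRing.isLinear.Build R ker_mod M *:%R ker_val ker_val_linear.

Lemma ker_valP y : f y = 0 <-> exists x, ker_val x = y.
Proof.
split=> [y0|[x <-]]; last by apply/eqP; exact: (submod_valP x).
by have yK : y \in Submodule ker_closed by [apply/eqP]; exists (SubmodType yK).
Qed.

End Kernel.

Section FreeResolution.
Variables (R : nzRingType) (M : lmodType R).

Fixpoint syzygy (n : nat) : lmodType R :=
  match n with
  | 0 => M
  | m.+1 => ker_mod (free_cover (syzygy m))
  end.

Definition free_obj (n : nat) : lmodType R := free_mod (syzygy n).

Definition free_diff (n : nat) : {linear free_obj n.+1 -> free_obj n} :=
  @ker_val _ _ _ (free_cover (syzygy n)) \o free_cover (syzygy n.+1).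

Lemma free_exact n x :
  free_cover (syzygy n) x = 0 <-> exists y, free_diff n y = x.
Proof.
split=> [/ker_valP[z <-]|[y <-]]; last by apply/ker_valP; eexists.
by have [y <-] := free_cover_surj z; exists y.
Qed.

Lemma free_exactS n x :
  free_diff n x = 0 <-> exists y, free_diff n.+1 y = x.
Proof.
split=> [x0|H].
  by apply: (free_exact (n := n.+1) x).1; apply: val_inj.
have /= x0 := (free_exact (n := n.+1) x).2 H.
by rewrite /free_diff /= x0 raddf0.
Qed.

Definition free_resolution : proj_resolution M :=
  ProjResolution (res_obj := free_obj) (fun n => @free_mod_projective _ _)
    (@free_cover_surj _ M) (free_exact (n := 0)) free_exactS.

End FreeResolution.

(* Main.v *)
(** Write A as a twisted tensor product of k[x]/(x^a) and k[y]/(y^b). Each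
    factor has the classical two-periodic bimodule resolution, with explicit
    contraction, and their twisted tensor product is a free bimodule resolution
    of A with generators e_i f_j of bidegree (|i|, |j|), where |2r| = r a and
    |2r + 1| = r a + 1 (respectively with b). In a monomial basis carrying the
    right powers of q the twist disappears, so that the contractions of the
    factors assemble to one of the total complex.

    Applying Hom(-, A) gives a double complex with basis the y^v x^u in position
    (i, j), graded by (u - |i|, v - |j|). In a fixed bidegree (m, n) it is the
    tensor product of two complexes with at most two terms: in the x-direction
    the differential is q^v - q^|j| or a norm element of q^v and q^|j|, which is
    invertible as soon as n <> 0 because q is not a root of unity, and every
    basis element is the source or the target of one of these maps unless
    m = a - 1. Hence only the bidegrees (a - 1, b - 1) and (0, 0) contribute:
    the first yields one class in degree 0, the second, in which all maps
    vanish, classes in degrees 0, 1, 1 and 2. *)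
Require Import Defs.
From HB Require Import structures.
From mathcomp Require Import all_boot all_algebra finmap.
From mathcomp Require Import boolp functions.
From mathcomp Require Import monalg.
From mathcomp Require Import zify ring.
Import Defs.

Set Implicit Arguments.
Unset Strict Implicit.
Unset Printing Implicit Defensive.

Import GRing.Theory.
Local Open Scope ring_scope.

(** * Comparison of projective resolutions *)

(** Chain maps and homotopies are built degree by degree: [good] is the invariant that keeps the
    next choice possible, [rel] what links consecutive choices. *)
Lemma dependent_choice_nat (T : nat -> Type) (good : forall n, T n -> Prop)
    (rel : forall n, T n -> T n.+1 -> Prop) (t0 : T 0) :
    good 0 t0 ->
    (forall n t, good n t -> exists t', good n.+1 t' /\ rel n t t') ->
  exists s : forall n, T n, s 0 = t0 /\ forall n, rel n (s n) (s n.+1).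
Proof.
move=> good0 step.
have [next nextP] : exists next : forall n, {t | good n t} -> {t | good n.+1 t},
    forall n u, rel n (sval u) (sval (next n u)).
  have H n (u : {t | good n t}) : exists u' : {t | good n.+1 t},
      rel n (sval u) (sval u').
    by have [t' [gt' rt']] := step n _ (svalP u); exists (exist _ t' gt').
  by exists (fun n u => sval (cid (H n u))) => n u; exact: svalP (cid (H n u)).
pose s := nat_rect (fun n => {t | good n t}) (exist _ t0 good0) next.
by exists (fun n => sval (s n)); split=> // n; exact: nextP.
Qed.

Section Comparison.
Variable R : nzRingType.

(** By exactness [f] corestricts to a surjection onto the kernel of [h], where [g] also takes its
    values; projectivity is applied to the corestrictions. *)
Lemma projective_lift_exact (P X Y Z : lmodType R) (f : {linear X -> Y})
    (h : {linear Y -> Z}) (g : {linear P -> Y}) :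
    projective P -> (forall y, h y = 0 -> exists x, f x = y) ->
    (forall x, h (f x) = 0) -> (forall p, h (g p) = 0) ->
  exists l : {linear P -> X}, forall p, f (l p) = g p.
Proof.
move=> projP ex hf hg.
pose K := Submodule (ker_closed h).
have inK (u : Y) : h u = 0 -> u \in K by move=> u0; apply/eqP.
pose f' (x : X) : ker_mod h := SubmodType (inK _ (hf x)).
pose g' (p : P) : ker_mod h := SubmodType (inK _ (hg p)).
have f'l : linear f' by move=> c x y; apply: val_inj; rewrite /= linearP.
have g'l : linear g' by move=> c x y; apply: val_inj; rewrite /= linearP.
pose F : {linear X -> ker_mod h} :=
  HB.pack f' (GRing.isLinear.Build R X (ker_mod h) *:%R f' f'l).
pose G : {linear P -> ker_mod h} :=
  HB.pack g' (GRing.isLinear.Build R P (ker_mod h) *:%R g' g'l).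
have [y|l lP] := projP _ _ F G.
  have /ex[x fx] : h (ker_val y) = 0 by apply/ker_valP; exists y.
  by exists x; apply: val_inj.
by exists l => p; have /(congr1 val) := lP p.
Qed.

Variable M : lmodType R.
Implicit Types P Q : proj_resolution M.

Lemma res_aug_diff P x : res_aug P (res_diff P 0 x) = 0.
Proof. by apply/res_exact0; exists x. Qed.

Lemma res_diff_diff P n x : res_diff P n (res_diff P n.+1 x) = 0.
Proof. by apply/res_exactS; exists x. Qed.

Definition chain_map P Q (phi : forall n, {linear res_obj P n -> res_obj Q n}) :=
  (forall x, res_aug Q (phi 0 x) = res_aug P x) /\
  (forall n x, res_diff Q n (phi n.+1 x) = phi n (res_diff P n x)).

Lemma chain_map_exists P Q : exists phi, @chain_map P Q phi.
Proof.
have [phi0 phi0P] :=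
  @res_proj _ _ P 0 _ _ (res_aug Q) (res_aug P) (@res_aug_surj _ _ Q).
(* In degree 0 the augmentation plays the part of the outgoing differential, so that one predicate
   states exactness in all degrees. *)
pose cyc (T : proj_resolution M) n : res_obj T n -> Prop :=
  match n return res_obj T n -> Prop with
  | 0 => fun x => res_aug T x = 0
  | m.+1 => fun x => res_diff T m x = 0 end.
have cyc_diff (T : proj_resolution M) n x : cyc T n (res_diff T n x).
  by case: n x => [|n] x /=; [exact: res_aug_diff | exact: res_diff_diff].
have cyc_exact (T : proj_resolution M) n x :
    cyc T n x -> exists y, res_diff T n y = x.
  by case: n x => [|n] x /= => [/res_exact0|/res_exactS].
pose good n (f : {linear res_obj P n -> res_obj Q n}) :=
  forall x, cyc P n x -> cyc Q n (f x).
pose rel n (f : {linear res_obj P n -> res_obj Q n})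
    (f' : {linear res_obj P n.+1 -> res_obj Q n.+1}) :=
  forall x, res_diff Q n (f' x) = f (res_diff P n x).
have [|n f gf|phi [phi0E phiP]] := @dependent_choice_nat _ good rel phi0.
- by move=> x /=; rewrite phi0P.
- have [l lP] : exists l : {linear res_obj P n.+1 -> res_obj Q n.+1},
      forall x, res_diff Q n (l x) = f (res_diff P n x).
    have hg x : cyc Q n (f (res_diff P n x)) by apply/gf/cyc_diff.
    case: n f gf hg => [|n] f gf hg.
      apply: (projective_lift_exact (f := res_diff Q 0) (h := res_aug Q)
        (g := f \o res_diff P 0)) => //.
      + exact: res_proj.
      + exact: (@cyc_exact Q 0).
      + exact: res_aug_diff.
    apply: (projective_lift_exact (f := res_diff Q n.+1) (h := res_diff Q n)
        (g := f \o res_diff P n.+1)) => //.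
    + exact: res_proj.
    + exact: (@cyc_exact Q n.+1).
    + exact: res_diff_diff.
  by exists l; split=> // x /= x0; rewrite lP x0 raddf0.
by exists phi; split=> // x; rewrite phi0E.
Qed.

Lemma chain_map_homotopic_id P (phi : forall n, {linear res_obj P n -> res_obj P n}) :
  chain_map phi ->
  exists s : forall n, {linear res_obj P n -> res_obj P n.+1},
    (forall x, phi 0 x - x = res_diff P 0 (s 0 x)) /\
    (forall n x, phi n.+1 x - x
       = res_diff P n.+1 (s n.+1 x) + s n (res_diff P n x)).
Proof.
case=> augE diffE.
have subid n : {f : {linear res_obj P n -> res_obj P n} |
    forall x, f x = phi n x - x}.
  by exists (phi n \- idfun)%R.
have [s0 s0P] : exists s0 : {linear res_obj P 0 -> res_obj P 1},
    forall x, res_diff P 0 (s0 x) = phi 0 x - x.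
  have [f fE] := subid 0.
  have [||||l lP] := projective_lift_exact (f := res_diff P 0)
    (h := res_aug P) (g := f).
  - exact: res_proj.
  - by move=> y /res_exact0.
  - exact: res_aug_diff.
  - by move=> x; rewrite fE linearB augE subrr.
  by exists l => x; rewrite lP fE.
(* The invariant says that [phi - id - s d] takes values in cycles, hence lifts through the next
   differential; the lift is the next [s]. *)
pose good n (s : {linear res_obj P n -> res_obj P n.+1}) :=
  forall x, res_diff P n (phi n.+1 x - x - s (res_diff P n x)) = 0.
pose rel n (s : {linear res_obj P n -> res_obj P n.+1})
    (s' : {linear res_obj P n.+1 -> res_obj P n.+2}) :=
  forall x, phi n.+1 x - x = res_diff P n.+1 (s' x) + s (res_diff P n x).
have [|n s gs|s [s0E sP]] := @dependent_choice_nat _ good rel s0.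
- by move=> x; rewrite !linearB /= diffE s0P subrr.
- have [f fE] := subid n.+1.
  have [||||l lP] := projective_lift_exact (f := res_diff P n.+1)
    (h := res_diff P n) (g := f \- (s \o res_diff P n))%R.
  + exact: res_proj.
  + by move=> y /res_exactS.
  + exact: res_diff_diff.
  + by move=> x; rewrite /= fE gs.
  have relE : rel n s l by move=> x; rewrite lP /= fE subrK.
  exists l; split=> // x.
  rewrite !linearB /= diffE lP /= fE res_diff_diff raddf0 subr0.
  by rewrite opprB addrA subrK subrr.
by exists s; split=> // x; rewrite s0E s0P.
Qed.

End Comparison.

(** * Dimension of Ext read off from one resolution *)

Lemma has_dim_quotmod (k : fieldType) (V : lmodType k) (S : submodule V) (m : nat)
    (ev : {linear V -> 'rV[k]_m}) :
    (forall r, exists v, ev v = r) -> (forall v, v \in S <-> ev v = 0) ->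
  has_dim (quotmod S) m.
Proof.
move=> surj kerE; have [s sE] := choice surj.
exists (fun i => quot_pi S (s (delta_mx 0 i))) => v.
have evE (c : 'rV[k]_m) : ev (\sum_(i < m) c 0 i *: s (delta_mx 0 i)) = c.
  rewrite linear_sum [RHS]row_sum_delta; apply: eq_bigr => i _.
  by rewrite linearZ sE.
have piE (c : 'rV[k]_m) : \sum_(i < m) c 0 i *: quot_pi S (s (delta_mx 0 i))
    = quot_pi S (\sum_(i < m) c 0 i *: s (delta_mx 0 i)).
  by rewrite linear_sum; apply: eq_bigr => i _; rewrite linearZ.
exists (ev (quot_repr v)); split=> [|c].
  rewrite piE -[v in LHS]quot_reprK; apply/quot_eqP/kerE.
  by rewrite linearB evE subrr.
rewrite piE -{1}[v]quot_reprK => /quot_eqP/kerE.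
by rewrite linearB evE => /eqP; rewrite subr_eq0 => /eqP.
Qed.

Section ExtComparison.
Variables (k : comNzRingType) (R : algType k) (M N : lmodType R).

Lemma precomp_coboundary (P Q : proj_resolution M)
    (phi : forall n, {linear res_obj P n -> res_obj Q n}) n
    (f : hom (res_obj Q n) N) : chain_map phi ->
  is_coboundary f -> is_coboundary (precomp (phi n) f).
Proof.
case=> _ diffE; case: n f => [|n] f /= => [->|[g ->]].
  by apply/homP.
exists (precomp (phi n) g); apply/homP => x /=.
by rewrite /hom_fun /= /hom_fun /= diffE.
Qed.

Lemma precomp_cocycle (P Q : proj_resolution M)
    (phi : forall n, {linear res_obj P n -> res_obj Q n}) n
    (f : hom (res_obj Q n) N) : chain_map phi ->
  f \in cocycles N Q n -> precomp (phi n) f \in cocycles N P n.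
Proof.
case=> _ diffE /eqP f0; apply/eqP/homP => x /=.
have /(congr1 (fun h : hom _ _ => hom_fun h (phi n.+1 x))) := f0.
by rewrite /hom_fun /= /hom_fun /= diffE.
Qed.

(** Of the two homotopy terms, [f] kills the one that is a boundary; the other is the coboundary of
    [f] composed with [s]. *)
Lemma precomp_homotopic_id (P : proj_resolution M)
    (phi : forall n, {linear res_obj P n -> res_obj P n}) n
    (f : hom (res_obj P n) N) : chain_map phi ->
  f \in cocycles N P n -> is_coboundary (precomp (phi n) f - f).
Proof.
move=> /chain_map_homotopic_id[s [s0P sP]] /eqP f0.
have f0E x : hom_fun f (res_diff P n x) = 0.
  by have /(congr1 (fun h : hom _ _ => hom_fun h x)) := f0.
case: n f f0 f0E => [|n] f f0 f0E /=.
  apply/homP => x; rewrite [LHS](_ : _ = hom_fun f (phi 0 x) - hom_fun f x) //.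
  transitivity (hom_fun f (phi 0 x - x)); first by rewrite linearB.
  by rewrite s0P f0E.
exists (precomp (s n) f); apply/homP => x.
rewrite [LHS](_ : _ = hom_fun f (phi n.+1 x) - hom_fun f x) //.
transitivity (hom_fun f (phi n.+1 x - x)); first by rewrite linearB.
by rewrite sP linearD /= f0E add0r.
Qed.

End ExtComparison.

(** Ext is formed with the given [P], while computations use a convenient [Q]. Chain maps in both
    directions, with composites homotopic to the identity, carry [ev] over. *)
Lemma has_dim_Ext (k : fieldType) (R : algType k) (M N : lmodType R)
    (P Q : proj_resolution M) (n m : nat)
    (ev : {linear hom (res_obj Q n) N -> 'rV[k]_m}) :
    (forall r, exists2 f, f \in cocycles N Q n & ev f = r) ->
    (forall f, f \in cocycles N Q n -> is_coboundary f <-> ev f = 0) ->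
  has_dim (Ext N P n) m.
Proof.
move=> surj kerE.
have [phi phiP] := chain_map_exists P Q.
have [psi psiP] := chain_map_exists Q P.
have comp_chain (P' Q' : proj_resolution M) f g :
    @chain_map _ _ P' Q' f -> @chain_map _ _ Q' P' g ->
    chain_map (fun n => (g n \o f n : {linear _ -> _})).
  move=> [f0 fS] [g0 gS]; split=> [x|l x] /=; first by rewrite g0 f0.
  by rewrite gS fS.
have cobB (T : proj_resolution M) (f g : hom (res_obj T n) N) :
    is_coboundary (f - g) -> is_coboundary g -> is_coboundary f.
  case: n f g {ev surj kerE} => [|l] f g /= => [/subr0_eq -> //|[u uE] [v vE]].
  by exists (u + v); rewrite linearD /= -uE -vE subrK.
have cobN (T : proj_resolution M) (f : hom (res_obj T n) N) :
    is_coboundary f -> is_coboundary (- f).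
  case: n f {ev surj kerE cobB} => [|l] f /= => [->|[u ->]]; first by rewrite oppr0.
  by exists (- u); rewrite linearN.
have evS : linear (fun f : submod_type (cocycles N P n) =>
    ev (precomp (psi n) (submod_val f))).
  by move=> c f g /=; rewrite !linearP.
pose evP : {linear submod_type (cocycles N P n) -> 'rV[k]_m} :=
  HB.pack (fun f : submod_type (cocycles N P n) =>
    ev (precomp (psi n) (submod_val f))) (GRing.isLinear.Build k _ _ _ _ evS).
apply: (has_dim_quotmod (ev := evP)) => [r|f].
  have [f fZ <-] := surj r.
  exists (SubmodType (precomp_cocycle phiP fZ)) => /=.
  have := precomp_homotopic_id (comp_chain _ _ _ _ psiP phiP) fZ.
  rewrite kerE; last first.
    rewrite rpredB //; apply: (precomp_cocycle (comp_chain _ _ _ _ psiP phiP)).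
    exact: fZ.
  by rewrite linearB => /subr0_eq <-; congr (ev _); apply: homP.
have fZ := submod_valP f.
have := kerE _ (precomp_cocycle psiP fZ); rewrite -/(evP f) => <-.
split=> [/asboolP|] fB; first exact: precomp_coboundary.
apply/asboolP; move: fB => /(precomp_coboundary phiP) fB.
apply: cobB fB.
rewrite (_ : precomp (phi n) _ = precomp (psi n \o phi n) (submod_val f)).
  rewrite -opprB; apply: cobN.
  exact: precomp_homotopic_id (comp_chain _ _ _ _ phiP psiP) fZ.
exact: homP.
Qed.

(** * Monomial basis of the quantum complete intersection *)

Section FreeAlgebraTheory.
Variables (k : comNzRingType) (I : choiceType).
Local Notation F := (free_alg k I).

Lemma free_alg_ind (T : F -> Prop) :
    T 1 -> (forall i g, T g -> T (free_gen k i * g)) ->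
    (forall c g h, T g -> T h -> T (c *: g + h)) ->
  forall g, T g.
Proof.
move=> T1 Tgen Tlin.
have T0 : T 0 by rewrite -(addNr 1) -scaleN1r; exact: Tlin.
have Tw (w : seq I) : T (<< FMonom w >> : {malg k[{fmonom I}]}).
  elim: w => [|i w IHw].
    by rewrite -[FMonom [::]]fmoneE.
  have -> : (<< FMonom (i :: w) >> : {malg k[{fmonom I}]})
      = free_gen k i * (<< FMonom w >> : {malg k[{fmonom I}]}) :> F.
    rewrite [RHS]fgmulUU mulr1; congr (<< _ >>).
    by rewrite [RHS]fmmulE fmuE.
  exact: Tgen.
move=> g; rewrite (monalgE (g : {malg k[{fmonom I}]})).
elim/big_rec: _ => //= w h _ Th.
have -> : << g@_w *g w >> = g@_w *: << w >> :> {malg k[{fmonom I}]}.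
  by apply/malgP => p; rewrite mcoeffZ [LHS]mcoeffU mcoeffU mulr_natr.
by apply: Tlin => //; case: w.
Qed.

Variables (V : lmodType k) (op : I -> {linear V -> V}).

(** The representation in which the generator [i] acts by [op i]; it serves to prove that the
    monomials are linearly independent modulo the relations. *)
Definition free_act (g : F) (v : V) : V :=
  \sum_(w <- msupp (g : {malg k[{fmonom I}]}))
     (g : {malg k[{fmonom I}]})@_w *: foldr (fun i => op i) v w.

Lemma free_actEw (d : {fset {fmonom I}}) (g : F) v :
  (msupp (g : {malg k[{fmonom I}]}) `<=` d)%fset ->
  free_act g v = \sum_(w <- d)
    (g : {malg k[{fmonom I}]})@_w *: foldr (fun i => op i) v w.
Proof.
move=> le; rewrite [LHS](big_fset_incl _ le) => //= x xd /mcoeff_outdom ->.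
by rewrite scale0r.
Qed.

Lemma free_act_linear v : linear (free_act^~ v).
Proof.
move=> c x y.
pose d := (msupp (x : {malg k[{fmonom I}]})
             `|` msupp (y : {malg k[{fmonom I}]}))%fset.
have lex : (msupp (x : {malg k[{fmonom I}]}) `<=` d)%fset by exact: fsubsetUl.
have ley : (msupp (y : {malg k[{fmonom I}]}) `<=` d)%fset by exact: fsubsetUr.
have lexy : (msupp ((c *: x + y : F) : {malg k[{fmonom I}]}) `<=` d)%fset.
  apply: fsubset_trans (msuppD_le _ _) _; apply: fsetSU; exact: msuppZ_le.
rewrite (free_actEw _ lex) (free_actEw _ ley) (free_actEw _ lexy).
rewrite scaler_sumr -big_split /=; apply: eq_bigr => p _.
by rewrite mcoeffD mcoeffZ scalerDl scalerA.
Qed.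

Definition free_act_on v (g : F) : V := free_act g v.

HB.instance Definition _ v :=
  GRing.isLinear.Build k F V *:%R (free_act_on v) (free_act_linear v).

Lemma free_actB g h v : free_act (g - h) v = free_act g v - free_act h v.
Proof. exact: (linearB (free_act_on v)). Qed.

Lemma free_actZ c g v : free_act (c *: g) v = c *: free_act g v.
Proof. exact: (linearZ_LR (free_act_on v)). Qed.

Lemma free_act1 v : free_act 1 v = v.
Proof.
rewrite /free_act (_ : 1 = mkmalgU (mone : {fmonom I}) (1 : k)) //.
rewrite msuppU oner_eq0 big_seq_fset1 mcoeffUU scale1r.
by rewrite (_ : (mone : {fmonom I}) = [::] :> seq I) ?fm1.
Qed.

Lemma free_act_genM i g v : free_act (free_gen k i * g) v = op i (free_act g v).
Proof.
have lin0 (f : F -> V) : linear f -> f 0 = 0.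
  by move=> fl; have := fl (-1) 0 0; rewrite scaler0 addr0 scaleN1r addNr.
have linD (f : F -> V) : linear f -> {morph f : x y / x + y}.
  by move=> fl x y; have := fl 1 x y; rewrite !scale1r.
have actU c (w : {fmonom I}) u :
    free_act (<< c *g w >> : {malg k[{fmonom I}]}) u
      = c *: foldr (fun i => op i) u w.
  by rewrite (free_actEw _ msuppU_le) big_seq_fset1 mcoeffUU.
rewrite [X in free_act X](_ : _ = fgmul (free_gen k i) g) //.
rewrite [fgmul _ _]fgmulUg.
rewrite (big_morph _ (linD _ (free_act_linear v)) (lin0 _ (free_act_linear v))).
rewrite [free_act g v]/free_act linear_sum; apply: eq_bigr => w _.
rewrite actU mul1r linearZ /=; congr (_ *: _).
by rewrite [X in foldr _ _ (val X)]fmmulE fmuE.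
Qed.

Lemma free_actr0 g : free_act g 0 = 0.
Proof.
elim/free_alg_ind: g => [|i g IHg|c g g' IHg IHg']; first exact: free_act1.
  by rewrite free_act_genM IHg linear0.
by rewrite [LHS](free_act_linear 0) IHg IHg' scaler0 addr0.
Qed.

Lemma free_actM g h v : free_act (g * h) v = free_act g (free_act h v).
Proof.
elim/free_alg_ind: g => [|i g IHg|c g g' IHg IHg'].
- by rewrite mul1r free_act1.
- rewrite -[_ * g * h]mulrA [LHS]free_act_genM [RHS]free_act_genM.
  exact: congr1 IHg.
- rewrite [(_ + _) * h]mulrDl -[_ *: g * h]scalerAl [LHS](free_act_linear v).
  rewrite [RHS](free_act_linear (free_act h v)).
  exact: congr2 (congr1 ( *:%R c) IHg) IHg'.
Qed.

End FreeAlgebraTheory.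

(** The interface through which the algebra enters the later argument: [mb_dual] and [mb_span] say
    that the y^v x^u in the box form a basis with coordinate functionals [cf]. *)
Record monomial_basis (k : fieldType) (q : k) (a b : nat) (A : algType k)
    (x y : A) (cf : nat -> nat -> {linear A -> k^o}) : Prop := MonomialBasis {
  mb_comm : x * y = q *: (y * x);
  mb_xa : x ^+ a = 0;
  mb_yb : y ^+ b = 0;
  mb_dual : forall u v s t, (s < a)%N -> (t < b)%N ->
    cf u v (y ^+ t * x ^+ s) = ((u == s) && (v == t))%:R;
  mb_span : forall m, m =
    \sum_(u < a) \sum_(v < b) cf u v m *: (y ^+ v * x ^+ u) }.

Section Monomials.
Variables (k : fieldType) (q : k) (A : algType k) (x y : A).
Hypothesis xy : x * y = q *: (y * x).

Lemma mulr_x_yX v : x * y ^+ v = q ^+ v *: (y ^+ v * x).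
Proof.
elim: v => [|v IHv]; first by rewrite !expr0 mul1r mulr1 scale1r.
rewrite !exprS mulrA xy -scalerAl -[y * x * _]mulrA IHv -scalerAr scalerA.
by rewrite mulrA.
Qed.

Lemma mulr_xX_yX u v : x ^+ u * y ^+ v = q ^+ (u * v) *: (y ^+ v * x ^+ u).
Proof.
elim: u => [|u IHu]; first by rewrite mul0n !expr0 mul1r mulr1 scale1r.
rewrite !exprS -mulrA IHu -scalerAr [x * (_ * _)]mulrA mulr_x_yX -scalerAl scalerA.
by rewrite -exprD -mulrA mulSnr.
Qed.

(** The elements equal to their own expansion form a subspace that contains 1 and is stable under
    left multiplication by x and y. *)
Lemma monomial_basis_of_generators (a b : nat)
    (cf : nat -> nat -> {linear A -> k^o}) :
    (0 < a)%N && (0 < b)%N ->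
    x ^+ a = 0 -> y ^+ b = 0 ->
    (forall u v s t, (s < a)%N -> (t < b)%N ->
      cf u v (y ^+ t * x ^+ s) = ((u == s) && (v == t))%:R) ->
    (forall T : A -> Prop, T 1 -> (forall m, T m -> T (x * m)) ->
      (forall m, T m -> T (y * m)) ->
      (forall c m m', T m -> T m' -> T (c *: m + m')) -> forall m, T m) ->
  monomial_basis q a b x y cf.
Proof.
move=> /andP[a0 b0] xa yb dual gen; split=> //.
pose sp (m : A) := m = \sum_(u < a) \sum_(v < b) cf u v m *: (y ^+ v * x ^+ u).
have spL c m1 m2 : sp m1 -> sp m2 -> sp (c *: m1 + m2).
  rewrite /sp => e1 e2; rewrite {1}e1 {1}e2 scaler_sumr -big_split /=.
  apply: eq_bigr => u _; rewrite scaler_sumr -big_split /=.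
  by apply: eq_bigr => v _; rewrite linearP scalerDl scalerA.
have sp0 : sp 0.
  by rewrite /sp big1 // => u _; rewrite big1 // => v _; rewrite linear0 scale0r.
have spZ c m1 : sp m1 -> sp (c *: m1).
  by move=> s1; rewrite -[c *: m1]addr0; exact: spL.
have spS (I : Type) (r : seq I) (E : I -> A) :
    (forall i, sp (E i)) -> sp (\sum_(i <- r) E i).
  move=> spE; elim/big_rec: _ => [|i m' _ spm']; first exact: sp0.
  by rewrite -[E i]scale1r; exact: spL.
have spM s t : sp (y ^+ t * x ^+ s).
  have [sa|/subnKC <-] := ltnP s a; last by rewrite exprD xa mul0r mulr0.
  have [tb|/subnKC <-] := ltnP t b; last by rewrite exprD yb !mul0r.
  rewrite /sp (bigD1 (Ordinal sa)) //= (bigD1 (Ordinal tb)) //=.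
  rewrite dual // !eqxx scale1r big1 => [|v]; last first.
    by rewrite -val_eqE /= => vt; rewrite dual // (negbTE vt) andbF scale0r.
  rewrite addr0 big1 ?addr0 // => u; rewrite -val_eqE /= => us.
  by rewrite big1 // => v _; rewrite dual // (negbTE us) scale0r.
apply: (gen sp) => [|m spm|m spm|//].
- by have := spM 0 0; rewrite !expr0 mulr1.
- rewrite spm mulr_sumr; apply: (spS) => u; rewrite mulr_sumr; apply: spS => v.
  rewrite -scalerAr mulrA mulr_x_yX -scalerAl -mulrA -exprS.
  by apply/spZ/spZ/spM.
- rewrite spm mulr_sumr; apply: (spS) => u; rewrite mulr_sumr; apply: spS => v.
  rewrite -scalerAr mulrA -exprS.
  by apply/spZ/spM.
Qed.

End Monomials.

Section QciBasis.
Variables (k : fieldType) (q : k) (a b : nat).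
Hypotheses (a2 : (2 <= a)%N) (b2 : (2 <= b)%N).

Local Notation F := (free_alg k 'I_2).
Local Notation fX := (free_gen k (ord0 : 'I_2)).
Local Notation fY := (free_gen k (ord_max : 'I_2)).
Local Notation A := (qci q a2 b2).
Local Notation I := (gen_ideal (qci_proper q a2 b2)).

Definition qci_x : A := quotalg_pi I fX.
Definition qci_y : A := quotalg_pi I fY.

Lemma qci_pi0 g : qci_rel q a b g -> quotalg_pi I g = 0.
Proof.
move=> rg; rewrite -[RHS](linear0 (quotalg_pi I)); apply/quot_eqP.
by rewrite subr0; apply/asboolP => S _ _; apply.
Qed.

Lemma qci_xX : qci_x ^+ a = 0.
Proof. by rewrite -rmorphXn; apply/qci_pi0/QciX. Qed.

Lemma qci_yX : qci_y ^+ b = 0.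
Proof. by rewrite -rmorphXn; apply/qci_pi0/QciY. Qed.

Lemma qci_xy : qci_x * qci_y = q *: (qci_y * qci_x).
Proof.
apply: subr0_eq.
rewrite -[qci_x * _]rmorphM -[qci_y * _]rmorphM -linearZ -linearB.
exact/qci_pi0/QciXY.
Qed.

(* Left multiplication by x and y, on the coefficients of the y^v x^u.         *)
Local Notation V := (nat -> nat -> k^o).

Definition coefX (f : V) : V := fun u v =>
  if (0 < u < a)%N then q ^+ v *: f u.-1 v else 0.
Definition coefY (f : V) : V := fun u v =>
  if (0 < v < b)%N then f u v.-1 else 0.

Lemma coefX_linear : linear coefX.
Proof.
move=> c f g; apply: funext => u; apply: funext => v.
rewrite [RHS](_ : _ = c *: coefX f u v + coefX g u v) // /coefX.
case: ifP => _; last by rewrite scaler0 addr0.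
rewrite (_ : (c *: f + g) u.-1 v = c *: f u.-1 v + g u.-1 v) //.
by rewrite scalerDr !scalerA mulrC.
Qed.

Lemma coefY_linear : linear coefY.
Proof.
move=> c f g; apply: funext => u; apply: funext => v.
rewrite [RHS](_ : _ = c *: coefY f u v + coefY g u v) // /coefY.
by case: ifP => _; rewrite ?scaler0 ?addr0.
Qed.

HB.instance Definition _ := GRing.isLinear.Build k V V *:%R coefX coefX_linear.
HB.instance Definition _ := GRing.isLinear.Build k V V *:%R coefY coefY_linear.

Definition coef_op (i : 'I_2) : {linear V -> V} :=
  if i == ord0 then coefX : {linear V -> V} else coefY.

Local Notation act := (free_act coef_op).

Lemma act_gen i f : act (free_gen k i) f = coef_op i f.
Proof. by rewrite -[free_gen k i]mulr1 free_act_genM free_act1. Qed.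

(** The case n = 0 stands apart because [f] may be nonzero outside the box, and only a positive
    power truncates it. *)
Lemma actX n f u v : act (fX ^+ n) f u v =
  if n is 0 then f u v else
  if (n <= u < a)%N then q ^+ (v * n) *: f (u - n)%N v else 0.
Proof.
elim: n u v => [|n IHn] u v; first by rewrite expr0 free_act1.
rewrite exprS free_act_genM [LHS](_ : _ = coefX (act (fX ^+ n) f) u v) //.
rewrite /coefX IHn; case: u => [|u] //=; rewrite ltnS.
have [ua|ua] := ltnP u.+1 a; last by rewrite andbF.
rewrite andbT; case: n {IHn} => [|n]; first by rewrite muln1 subn1.
rewrite (ltnW ua) andbT subSS; case: ifP => _; last by rewrite scaler0.
by rewrite scalerA -exprD -mulnS.
Qed.

Lemma actY n f u v : act (fY ^+ n) f u v =
  if n is 0 then f u v else if (n <= v < b)%N then f u (v - n)%N else 0.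
Proof.
elim: n u v => [|n IHn] u v; first by rewrite expr0 free_act1.
rewrite exprS free_act_genM [LHS](_ : _ = coefY (act (fY ^+ n) f) u v) //.
rewrite /coefY IHn; case: v => [|v] //=; rewrite ltnS.
have [vb|vb] := ltnP v.+1 b; last by rewrite andbF.
rewrite andbT; case: n {IHn} => [|n]; first by rewrite subn1.
by rewrite (ltnW vb) andbT subSS.
Qed.

(** The operators [coefX] and [coefY] satisfy the three defining relations, so the action descends
    to the quotient. *)
Lemma act_rel g : g \in I -> forall f, act g f = 0.
Proof.
have clS : submod_closed (fun g : F => `[< forall f, act g f = 0 >]).
  split=> [|c g1 g2 /asboolP g10 /asboolP g20].
    by apply/asboolP => f; rewrite -(subrr 1) free_actB subrr.
  apply/asboolP => f.
  by rewrite [LHS](free_act_linear coef_op f) g10 g20 scaler0 addr0.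
move=> gI f; suff /asboolP : g \in Submodule clS by apply.
move/asboolP: gI; apply=> [p s /asboolP s0|p s /asboolP s0|_ []].
- by apply/asboolP => h; rewrite free_actM s0 free_actr0.
- by apply/asboolP => h; rewrite free_actM s0.
- apply/asboolP => h; apply: funext => u; apply: funext => v; rewrite actX.
  by case: a a2 => // n _; case: ifP => // /andP[/leq_ltn_trans/[apply]]; rewrite ltnn.
- apply/asboolP => h.
  rewrite [LHS]free_actB.
  rewrite [X in _ - X]free_actZ.
  rewrite [X in X - _]free_act_genM.
  rewrite [X in _ - _ *: X]free_act_genM.
  rewrite [X in X - _](congr1 (coef_op ord0) (act_gen ord_max h)).
  rewrite [X in _ - _ *: X](congr1 (coef_op ord_max) (act_gen ord0 h)).
  apply/eqP; rewrite subr_eq0; apply/eqP.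
  apply: funext => u; apply: funext => v.
  rewrite [LHS](_ : _ = coefX (coefY h) u v) //.
  rewrite [RHS](_ : _ = q *: coefY (coefX h) u v) // /coefX /coefY.
  case: u => [|u]; first by case: ifP; rewrite ?scaler0.
  case: v => [|v]; first by case: ifP; rewrite ?scaler0.
  by do 2!case: ifP => _; rewrite ?scaler0 ?scalerA -?exprS.
- apply/asboolP => h; apply: funext => u; apply: funext => v; rewrite actY.
  by case: b b2 => // n _; case: ifP => // /andP[/leq_ltn_trans/[apply]]; rewrite ltnn.
Qed.

Definition coef_delta : V := fun u v => ((u == 0) && (v == 0))%N%:R.

(** As in the regular representation, m is applied to the unit monomial [coef_delta]; by [act_rel]
    the choice of representative does not matter. *)
Definition qci_coef u v (m : A) : k^o := act (quot_repr m) coef_delta u v.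

Lemma qci_coef_pi u v g : qci_coef u v (quotalg_pi I g) = act g coef_delta u v.
Proof.
have rg : quot_repr (quotalg_pi I g) - g \in I.
  by apply/quot_eqP/quot_reprK.
have /eqP := act_rel rg coef_delta.
by rewrite free_actB subr_eq0 /qci_coef => /eqP ->.
Qed.

Lemma qci_coef_linear u v : linear (qci_coef u v).
Proof.
move=> c m m'; rewrite -[m]quot_reprK -[m']quot_reprK.
rewrite -[quot_pi _ _]/(quotalg_pi I _) -[quot_pi _ (quot_repr m')]/(quotalg_pi I _).
rewrite -linearP !qci_coef_pi.
by rewrite [act _ _](free_act_linear coef_op coef_delta).
Qed.

HB.instance Definition _ u v :=
  GRing.isLinear.Build k A k^o *:%R (qci_coef u v) (qci_coef_linear u v).

Lemma qci_coef_dual u v s t : (s < a)%N -> (t < b)%N ->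
  qci_coef u v (qci_y ^+ t * qci_x ^+ s) = ((u == s) && (v == t))%:R.
Proof.
move=> sa tb; rewrite -!rmorphXn -rmorphM qci_coef_pi free_actM actY.
(* [coef_delta] is supported at w = 0, where the factor q^(w s) from [actX] is 1. *)
have X w : act (fX ^+ s) coef_delta u w = ((u == s) && (w == 0))%N%:R.
  rewrite actX; case: s sa => [//|s] sa; case: ifP => [/andP[su ua]|].
    rewrite /coef_delta subn_eq0 [u == _]eqn_leq su andbT.
    case: w => [|w]; first by rewrite scale1r.
    by rewrite !andbF scaler0.
  by have [->|//] := eqVneq u s.+1; rewrite leqnn sa.
case: t tb => [|t] tb; first exact: X.
case: ifP => [/andP[tv vb]|]; first by rewrite X subn_eq0 [v == _]eqn_leq tv andbT.
by have [->|] := eqVneq v t.+1; rewrite ?andbF // leqnn tb.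
Qed.

Lemma qci_monomial_basis :
  monomial_basis q a b qci_x qci_y (fun u v => qci_coef u v : {linear A -> k^o}).
Proof.
apply: monomial_basis_of_generators.
- exact: qci_xy.
- by apply/andP; split; exact: ltnW.
- exact: qci_xX.
- exact: qci_yX.
- exact: qci_coef_dual.
move=> T T1 Tx Ty Tl m; rewrite -[m]quot_reprK -[quot_pi _ _]/(quotalg_pi I _).
elim/free_alg_ind: (quot_repr m) => [|i g Tg|c g h Tg Th].
- by rewrite rmorph1.
- rewrite rmorphM; case: i => [[|[|//]] ilt].
    rewrite (_ : Ordinal ilt = ord0) //; first exact: Tx.
    exact: val_inj.
  rewrite (_ : Ordinal ilt = ord_max) //; first exact: Ty.
  exact: val_inj.
- by rewrite linearP; apply: Tl.
Qed.

End QciBasis.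

(** * Homotopies and total complexes *)

(* [F u u'] stands for x^u e_i x^u' in the two-periodic bimodule resolution    *)
(* of k[x]/(x^N) with generators e_i of degree [kdeg N i]; [khtpy] is its      *)
(* contraction, linear for right multiplication by x.                         *)
Section TruncatedResolution.
Variable N : nat.

Definition kstep i := if odd i then N.-1 else 1%N.
Fixpoint kdeg i := if i is i'.+1 then (kdeg i' + kstep i')%N else 0%N.

Section Formal.
Variable V : zmodType.
Implicit Types (F : nat -> nat -> V) (u : nat).

(** The differential from degree i + 1 to i: left minus right multiplication by x, or the sum over
    all splittings of x^(N-1). Acting on arrays, it serves both variables and any target. *)
Definition kdiff i F u u' : V :=
  if odd i then \sum_(t < N) F (u + t)%N (u' + (N.-1 - t))%N
  else F u.+1 u' - F u u'.+1.

Definition khtpy i F u u' : V :=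
  if odd i then (if u == N.-1 then F 0%N u' else 0)
  else if (u < N)%N then \sum_(t < u) F t (u.-1 - t + u')%N else 0.

(** The augmentation followed by the section sending x^n to e_0 x^n. *)
Definition kproj F u u' : V := if (u < N)%N then F 0%N (u + u')%N else 0.

(** Encodes x^N = 0 on either side. *)
Definition boxed F := forall u u', (N <= u)%N || (N <= u')%N -> F u u' = 0.

Lemma eq_kdiff i F G u u' : (forall s s', F s s' = G s s') ->
  kdiff i F u u' = kdiff i G u u'.
Proof.
by move=> FG; rewrite /kdiff !FG; case: ifP => // _; apply: eq_bigr.
Qed.

Lemma eq_khtpy i F G u u' : (forall s s', F s s' = G s s') ->
  khtpy i F u u' = khtpy i G u u'.
Proof.
move=> FG; rewrite /khtpy !FG; case: ifP => // _; case: ifP => // _.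
exact: eq_bigr.
Qed.

(** The difference of the two sides telescopes to two end terms, one with left and one with right
    exponent at least N. *)
Lemma kdiff_sum_shift F u u' : boxed F ->
  \sum_(t < N) F (u.+1 + t)%N (u' + (N.-1 - t))%N
    = \sum_(t < N) F (u + t)%N (u'.+1 + (N.-1 - t))%N.
Proof.
move=> boxF; apply/eqP; rewrite -subr_eq0 -sumrB.
pose G t := F (u + t)%N (u' + (N - t))%N.
rewrite (eq_bigr (fun t : 'I_N => G t.+1 - G t)).
  rewrite -(big_mkord xpredT (fun t => G t.+1 - G t)) telescope_sumr //.
  by rewrite /G !boxF ?subrr //; lia.
by move=> t _; congr (F _ _ - F _ _); have := ltn_ord t; lia.
Qed.

Lemma kdiff_kdiff i F u u' : boxed F -> kdiff i.+1 (kdiff i F) u u' = 0.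
Proof.
move=> boxF; rewrite /kdiff /=; case: (odd i) => /=; rewrite ?sumrB.
  by apply/eqP; rewrite subr_eq0; apply/eqP; exact: kdiff_sum_shift.
by apply/eqP; rewrite subr_eq0; apply/eqP; exact: kdiff_sum_shift.
Qed.

Lemma khtpy0_kdiff0 F u u' : boxed F ->
  khtpy 0 (kdiff 0 F) u u' = F u u' - kproj F u u'.
Proof.
move=> boxF; rewrite /khtpy /kproj /=; case: ltnP => uN; last first.
  by rewrite boxF ?uN // subr0.
pose G t := F t (u - t + u')%N.
rewrite (eq_bigr (fun t : 'I_u => G t.+1 - G t)).
  rewrite -(big_mkord xpredT (fun t => G t.+1 - G t)) telescope_sumr //.
  by rewrite /G subnn subn0 add0n.
by move=> t _; congr (F _ _ - F _ _); have := ltn_ord t; lia.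
Qed.

Lemma khtpy_kdiff i F u u' : (0 < N)%N -> boxed F ->
  khtpy i.+1 (kdiff i.+1 F) u u' + kdiff i (khtpy i F) u u' = F u u'.
Proof.
move=> N0 boxF; case oi: (odd i).
  have -> : khtpy i.+1 (kdiff i.+1 F) u u' = khtpy 0 (kdiff 0 F) u u'.
    by rewrite /khtpy /kdiff /= oi.
  rewrite khtpy0_kdiff0 // /kdiff oi.
  rewrite (_ : \sum_(t < N) _ = kproj F u u') ?subrK //.
  rewrite /kproj /khtpy oi; case: ltnP => uN; last first.
    by rewrite big1 // => t _; case: eqP => //; lia.
  (* Only t = N.-1 - u reaches the exponent N.-1 at which [khtpy] in odd degree is nonzero. *)
  have tN : (N.-1 - u < N)%N by lia.
  rewrite (bigD1 (Ordinal tN)) //= big1 => [|t].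
    have -> : (u + (N.-1 - u) == N.-1)%N by lia.
    by rewrite addr0; congr (F _ _); lia.
  by rewrite -val_eqE /= => ne; case: eqP => //; lia.
rewrite /khtpy /kdiff /= oi /=.
have [uN|uN] := ltnP u N; last first.
  have -> : (u == N.-1) = false by lia.
  have -> : (u.+1 < N)%N = false by lia.
  by rewrite subr0 addr0 boxF // uN.
have [uN1|uN1] := ltnP u.+1 N.
  have -> : (u == N.-1) = false by lia.
  rewrite big_ord_recr /= subnn add0n add0r.
  rewrite [X in X + _ - _](eq_bigr (fun t : 'I_u => F t (u.-1 - t + u'.+1)%N)).
    by rewrite addrC addKr.
  by move=> t _; congr (F _ _); have := ltn_ord t; lia.
(* At u = N.-1 the sum at u.+1 is cut off by the box, and the sum coming from [khtpy i.+1] takes its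
   place. *)
have -> : (u == N.-1) by lia.
have EN : N = u.+1 by lia.
rewrite sub0r EN big_ord_recr /= add0n subnn addn0.
rewrite [X in X + _ - _](eq_bigr (fun t : 'I_u => F t (u.-1 - t + u'.+1)%N)).
  by rewrite addrC addKr.
by move=> t _; congr (F _ _); have := ltn_ord t; lia.
Qed.

Lemma kdiff0_kproj F u u' : boxed F -> kdiff 0 (kproj F) u u' = 0.
Proof.
move=> boxF; rewrite /kdiff /kproj /=.
have [uN|uN] := ltnP u.+1 N.
  by rewrite (ltnW uN) addSnnS subrr.
by case: ifP => _; rewrite ?subrr // sub0r boxF ?oppr0 //; lia.
Qed.

Lemma boxed_khtpy i F : boxed F -> boxed (khtpy i F).
Proof.
move=> boxF u u' uN; rewrite /khtpy; case: ifP => _; case: ifP => // h.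
  by rewrite boxF //; lia.
by rewrite big1 // => t _; rewrite boxF //; lia.
Qed.

Lemma boxed_kproj F : boxed F -> boxed (kproj F).
Proof.
by move=> boxF u u' uN; rewrite /kproj; case: ifP => // h; rewrite boxF //; lia.
Qed.

End Formal.

Section Naturality.
Variables (V W : zmodType) (h : {additive V -> W}).

Lemma raddf_kdiff i (F : nat -> nat -> V) u u' :
  h (kdiff i F u u') = kdiff i (fun s s' => h (F s s')) u u'.
Proof. by rewrite /kdiff; case: ifP => _; rewrite ?raddf_sum ?raddfB. Qed.

Lemma raddf_khtpy i (F : nat -> nat -> V) u u' :
  h (khtpy i F u u') = khtpy i (fun s s' => h (F s s')) u u'.
Proof.
rewrite /khtpy; case: ifP => _; case: ifP => _; rewrite ?raddf0 //.
by rewrite raddf_sum.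
Qed.

Lemma raddf_kproj (F : nat -> nat -> V) u u' :
  h (kproj F u u') = kproj (fun s s' => h (F s s')) u u'.
Proof. by rewrite /kproj; case: ifP => _; rewrite ?raddf0. Qed.

End Naturality.

End TruncatedResolution.

(** * Commutation of the operators in x with those in y *)

Section Interchange.
Variables (N M : nat) (V : zmodType).
Implicit Types F : nat -> nat -> nat -> nat -> V.

Lemma kdiffC i j F u u' v v' :
  kdiff N i (fun s s' => kdiff M j (F s s') v v') u u'
    = kdiff M j (fun t t' => kdiff N i (fun s s' => F s s' t t') u u') v v'.
Proof.
rewrite /kdiff; do 2!case: ifP => _; rewrite -?sumrB //; first exact: exchange_big.
by rewrite !opprB addrACA [RHS]addrACA [- _ + _]addrC.
Qed.

Lemma khtpy_kdiffC i j F u u' v v' :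
  khtpy N i (fun s s' => kdiff M j (F s s') v v') u u'
    = kdiff M j (fun t t' => khtpy N i (fun s s' => F s s' t t') u u') v v'.
Proof.
rewrite /khtpy /kdiff; do 2!case: ifP => _; try case: ifP => _;
  rewrite ?subrr ?sumrB ?big1_eq //.
exact: exchange_big.
Qed.

Lemma kproj_kdiffC j F u u' v v' :
  kproj N (fun s s' => kdiff M j (F s s') v v') u u'
    = kdiff M j (fun t t' => kproj N (fun s s' => F s s' t t') u u') v v'.
Proof.
by rewrite /kproj /kdiff; do 2!case: ifP => _; rewrite ?subrr ?big1_eq.
Qed.

End Interchange.

(* Total complex of a first-quadrant double complex all of whose terms have   *)
(* the carrier [T]: [sx], [px] contract the rows onto their augmentation and  *)
(* [sy], [py] contract the zeroth column.                                     *)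
Section TotalComplex.
Variables (k : fieldType) (T : lmodType k).
Variables (dx dy sx : nat -> nat -> {linear T -> T}).
Variables (px sy : nat -> {linear T -> T}) (py : {linear T -> T}).

Definition tot_diff (f : nat -> nat -> T) i j : T :=
  dx i j (f i.+1 j) + (-1) ^+ i *: dy i j (f i j.+1).

Definition tot_htpy (f : nat -> nat -> T) i j : T :=
  match i, j with
  | i'.+1, _ => sx i' j (f i' j)
  | 0, j'.+1 => sy j' (px j' (f 0%N j'))
  | 0, 0 => 0
  end.

Hypothesis dxdx : forall i j z, dx i j (dx i.+1 j z) = 0.
Hypothesis dydy : forall i j z, dy i j (dy i j.+1 z) = 0.
Hypothesis dxdy : forall i j z, dx i j (dy i.+1 j z) = dy i j (dx i j.+1 z).

Lemma tot_diff_diff f i j : tot_diff (tot_diff f) i j = 0.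
Proof.
rewrite /tot_diff !linearD !linearZ /= dxdx add0r dydy !scaler0 addr0 dxdy.
by rewrite exprS mulN1r scaleNr addNr.
Qed.

Hypothesis dxsx0 : forall j z, dx 0 j (sx 0 j z) = z - px j z.
Hypothesis dxsx : forall i j z, dx i.+1 j (sx i.+1 j z) + sx i j (dx i j z) = z.
Hypothesis pxdx : forall j z, px j (dx 0 j z) = 0.
Hypothesis sxdy : forall i j z, dy i.+1 j (sx i j.+1 z) = sx i j (dy i j z).
Hypothesis pxdy : forall j z, dy 0 j (px j.+1 z) = px j (dy 0 j z).
Hypothesis dysy0 : forall z, dy 0 0 (sy 0 z) = z - py z.
Hypothesis dysy : forall j z, dy 0 j.+1 (sy j.+1 z) + sy j (dy 0 j z) = z.

(** Away from the zeroth column the rows contract, and the sign in [tot_diff] cancels the mixed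
    terms. In the zeroth column [px] is left over and is contracted in turn by [sy], up to [py] at
    the origin. *)
Lemma tot_htpyP f i j : tot_diff (tot_htpy f) i j + tot_htpy (tot_diff f) i j =
  f i j - (if (i == 0%N) && (j == 0%N) then py (px 0%N (f 0%N 0%N)) else 0).
Proof.
rewrite /tot_diff; case: i => [|i] /=.
  rewrite expr0 scale1r dxsx0; case: j => [|j] /=.
    by rewrite dysy0 addr0 addrA subrK.
  rewrite scale1r linearD /= pxdx add0r -pxdy subr0.
  by rewrite -addrA dysy subrK.
rewrite linearD /= linearZ /= sxdy subr0 addrACA dxsx.
by rewrite exprS mulN1r scaleNr addNr addr0.
Qed.

End TotalComplex.

Section Boxed.
Variables (V : zmodType) (N M i u u' : nat) (F : nat -> nat -> nat -> nat -> V).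
Hypothesis boxF : forall s s', boxed M (F s s').

Lemma boxed_khtpy_arg : boxed M (fun v v' => khtpy N i (fun s s' => F s s' v v') u u').
Proof.
move=> v v' h; rewrite /khtpy !boxF //; case: ifP => _; case: ifP => // _.
by rewrite big1 // => t _; rewrite boxF.
Qed.

Lemma boxed_kproj_arg : boxed M (fun v v' => kproj N (fun s s' => F s s' v v') u u').
Proof. by move=> v v' h; rewrite /kproj !boxF //; case: ifP. Qed.

End Boxed.

(** * Free modules on the diagonals of the total complex *)

Definition on_diag (V : zmodType) n (f : nat -> nat -> V) :=
  forall i j, (i + j)%N != n -> f i j = 0.

Section DiagonalModule.
Variables (E : nzRingType) (n : nat).

(* The free module on the pairs (i, j) with i + j = n, indexed by i. *)
Definition diagmod : lmodType E := {ffun 'I_n.+1 -> E^o}.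

(** Extension by zero off the diagonal turns elements of every degree into arrays on one index set,
    as [tot_diff] expects. *)
Definition diag_at (f : diagmod) (i j : nat) : E :=
  if (i + j == n)%N then (f : {ffun 'I_n.+1 -> E^o}) (inord i) else 0.

Lemma diag_atP f : on_diag n (diag_at f).
Proof. by move=> i j /negbTE ij; rewrite /diag_at ij. Qed.

Definition diag_of (f : nat -> nat -> E) : diagmod :=
  [ffun i : 'I_n.+1 => f i (n - i)%N : E^o].

Lemma diag_ofK f i j : (i + j)%N = n -> diag_at (diag_of f) i j = f i j.
Proof.
move=> ij; rewrite /diag_at ij eqxx ffunE inordK; last by lia.
by congr (f _ _); lia.
Qed.

Lemma diag_at_linear c f g i j :
  diag_at (c *: f + g) i j = c * diag_at f i j + diag_at g i j.
Proof.
by rewrite /diag_at; case: ifP => _; rewrite ?mulr0 ?addr0 // !ffunE.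
Qed.

Lemma diag_at0 i j : diag_at 0 i j = 0.
Proof. by rewrite /diag_at; case: ifP => _; rewrite // ffunE. Qed.

Lemma diagP (f g : diagmod) :
  (forall i j, (i + j)%N = n -> diag_at f i j = diag_at g i j) -> f = g.
Proof.
move=> fg; apply/ffunP => i; have lti := ltn_ord i.
have /fg : (i + (n - i))%N = n by lia.
by rewrite /diag_at subnKC ?eqxx ?inord_val //; lia.
Qed.

Definition diag_gen i j : diagmod :=
  diag_of (fun i' j' => ((i' == i) && (j' == j))%:R).

Variable N : lmodType E.

Definition diag_ext (m : nat -> nat -> N) (f : diagmod) : N :=
  \sum_(i < n.+1) diag_at f i (n - i)%N *: m i (n - i)%N.

Lemma diag_ext_linear m : linear (diag_ext m).
Proof.
move=> c f g; rewrite /diag_ext scaler_sumr -big_split /=.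
by apply: eq_bigr => i _; rewrite diag_at_linear scalerDl scalerA.
Qed.

HB.instance Definition _ m :=
  GRing.isLinear.Build E diagmod N *:%R (diag_ext m) (diag_ext_linear m).

Lemma diag_ext_gen m i j : (i + j)%N = n -> diag_ext m (diag_gen i j) = m i j.
Proof.
move=> ij; have ilt : (i < n.+1)%N by lia.
rewrite /diag_ext (bigD1 (Ordinal ilt)) //= big1 => [|i'].
  have -> : (n - i)%N = j by lia.
  by rewrite diag_ofK // !eqxx scale1r addr0.
rewrite -val_eqE /= => /negbTE ne; have lti := ltn_ord i'.
by rewrite diag_ofK ?ne ?scale0r //; lia.
Qed.

End DiagonalModule.

Section DiagonalLinear.
Variables (E : nzRingType) (n : nat) (N : lmodType E).

Lemma diag_linearE (g : {linear diagmod E n -> N}) f :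
  g f = diag_ext (fun i j => g (diag_gen E n i j)) f.
Proof.
have atD i j : {morph (fun h : diagmod E n => diag_at h i j) : h h' / h + h'}.
  by move=> h h'; rewrite -[h]scale1r diag_at_linear mul1r scale1r.
have fE : f = \sum_(i < n.+1) diag_at f i (n - i)%N *: diag_gen E n i (n - i)%N.
  apply: diagP => i j ij; have ilt : (i < n.+1)%N by lia.
  rewrite (big_morph _ (atD i j) (@diag_at0 E n i j)).
  have atZ c h : diag_at (c *: h) i j = c * diag_at h i j :> E.
    by rewrite -[c *: h]addr0 diag_at_linear diag_at0 addr0.
  rewrite (bigD1 (Ordinal ilt)) //= big1 => [|i'].
    have -> : (n - i)%N = j by lia.
    by rewrite addr0 atZ diag_ofK // !eqxx mulr1.
  rewrite -val_eqE /= eq_sym => /negbTE ne.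
  by rewrite atZ diag_ofK // ne mulr0.
rewrite {1}fE linear_sum.
by apply: eq_bigr => i _; rewrite linearZ.
Qed.

End DiagonalLinear.

Lemma diagmod_projective (E : nzRingType) n : projective (diagmod E n).
Proof.
move=> M N f g f_surj.
have [s sE] := choice (fun p : nat * nat => f_surj (g (diag_gen E n p.1 p.2))).
exists (diag_ext (fun i j => s (i, j))) => z.
rewrite [RHS]diag_linearE /= /diag_ext linear_sum.
by apply: eq_bigr => i _; rewrite linearZ sE.
Qed.

(** * The bigraded complex of coefficients *)

Section KoszulCochains.
Variables (k : fieldType) (q : k) (a b : nat).

(** The scalar of [kdiff] on a monomial when left and right multiplication contribute powers of z
    and w. For x, passing y^v gives z = q^v and passing f_j gives w = q^(kdeg b j). *)
Definition step_coef N i (z w : k) : k :=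
  if odd i then \sum_(t < N) z ^+ t * w ^+ (N.-1 - t) else z - w.

Definition cobdx_coef i j v : k := step_coef a i (q ^+ v) (q ^+ kdeg b j).
Definition cobdy_coef i j u : k := step_coef b j (q ^+ kdeg a i) (q ^+ u).

(* A cochain is given by the coefficient [g i j u v] of y^v x^u in position    *)
(* (i, j); up to a scalar, the x-part of the coboundary moves y^v x^u to       *)
(* y^v x^(u + kstep a i) in position (i + 1, j), and similarly for the y-part. *)
Definition prev_term N i u (f : nat -> nat -> k) : k :=
  if i is i'.+1 then
    if (kstep N i' <= u)%N then f i' (u - kstep N i')%N else 0
  else 0.

Definition cobd (g : nat -> nat -> nat -> nat -> k) i j u v : k :=
  prev_term a i u (fun i' u' => cobdx_coef i' j v * g i' j u' v)
  + (-1) ^+ i * prev_term b j v (fun j' v' => cobdy_coef i j' u * g i j' u v').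

Lemma step_coefM N i s z w :
  step_coef N i (s * z) (s * w) = s ^+ kstep N i * step_coef N i z w.
Proof.
rewrite /step_coef /kstep; case: ifP => _; last by rewrite mulrBr.
rewrite mulr_sumr; apply: eq_bigr => t _; rewrite !exprMn mulrACA -exprD.
by congr (_ ^+ _ * _); have := ltn_ord t; lia.
Qed.

Lemma cobdx_coefS i j v :
  cobdx_coef i j.+1 (v + kstep b j) = q ^+ (kstep b j * kstep a i) * cobdx_coef i j v.
Proof.
rewrite /cobdx_coef /= ![q ^+ (_ + _)]exprD ![_ * q ^+ kstep b j]mulrC.
by rewrite step_coefM exprM.
Qed.

Lemma cobdy_coefS i j u :
  cobdy_coef i.+1 j (u + kstep a i) = q ^+ (kstep b j * kstep a i) * cobdy_coef i j u.
Proof.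
rewrite /cobdy_coef /= ![q ^+ (_ + _)]exprD ![_ * q ^+ kstep a i]mulrC step_coefM.
by rewrite -exprM mulnC.
Qed.

(** A step in the other direction multiplies either coefficient by the same power q^(kstep b j *
    kstep a i), so the squares commute. *)
Lemma cobdx_cobdy i j u v : cobdx_coef i j v * cobdy_coef i.+1 j (u + kstep a i)
  = cobdx_coef i j.+1 (v + kstep b j) * cobdy_coef i j u.
Proof. by rewrite cobdx_coefS cobdy_coefS mulrCA mulrA. Qed.

Lemma kstepD N i : (0 < N)%N -> (kstep N i + kstep N i.+1)%N = N.
Proof. by rewrite /kstep /=; case: (odd i) => /=; lia. Qed.

Lemma prev_termS N i u f : prev_term N i.+1 (u + kstep N i) f = f i u.
Proof. by rewrite /prev_term leq_addl addnK. Qed.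

(** Consecutive steps add up to N, so a monomial hit by the incoming map is pushed out of the box by
    the outgoing one. A monomial not hit stays inside, except for the exponent N.-1 at i = 0. *)
Lemma prev_termP N i u : (0 < N)%N -> (u < N)%N ->
  (exists i' u', [/\ i = i'.+1, u = (u' + kstep N i')%N & (N <= u + kstep N i)%N])
  \/ ((forall f, prev_term N i u f = 0) /\
      ((u + kstep N i < N)%N \/ u = (N.-1 + kdeg N i)%N)).
Proof.
move=> N0 uN; case: i => [|i]; first by right; split=> //=; rewrite /kstep /=; lia.
have e := kstepD i N0.
have [le|lt] := leqP (kstep N i) u.
  by left; exists i, (u - kstep N i)%N; split=> //; lia.
by right; split=> [f|]; [rewrite /prev_term leqNgt lt | left; lia].
Qed.

Lemma kdeg_lt N i : (2 <= N)%N -> (kdeg N i < N)%N -> (i <= 1)%N.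
Proof.
case: i => [|[|i]] // N2; rewrite /= -addnA kstepD; lia.
Qed.

Hypotheses (a2 : (2 <= a)%N) (b2 : (2 <= b)%N) (q0 : q != 0).
Hypothesis qX1 : forall m, (0 < m)%N -> q ^+ m != 1.

Lemma qX_inj m n : q ^+ m = q ^+ n -> m = n.
Proof.
wlog le_mn : m n / (m <= n)%N.
  by move=> W; have [/W//|/ltnW/W W' /esym/W' //] := leqP m n.
rewrite -(subnKC le_mn) exprD -{1}[q ^+ m]mulr1.
move=> /(mulfI (expf_neq0 m q0))/esym/eqP e.
case: (posnP (n - m)) => [->|/qX1]; first by rewrite addn0.
by rewrite e.
Qed.

(** In the odd case the sum times q^n - q^m is q^(n N) - q^(m N), and distinct exponents give
    distinct powers of q. *)
Lemma step_coef_neq0 N i m n : (0 < N)%N -> m != n ->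
  step_coef N i (q ^+ m) (q ^+ n) != 0.
Proof.
move=> N0 mn; rewrite /step_coef; case: ifP => _; last first.
  by rewrite subr_eq0; apply: contra mn => /eqP/qX_inj ->.
apply/eqP => S0; have := subrXX (q ^+ n) (q ^+ m) N.
rewrite (eq_bigr (fun t : 'I_N => q ^+ m ^+ t * q ^+ n ^+ (N.-1 - t))) => [|t _].
  rewrite S0 mulr0 -!exprM => /eqP; rewrite subr_eq0 => /eqP/qX_inj/eqP.
  by rewrite eqn_pmul2r // eq_sym (negbTE mn).
by rewrite mulrC.
Qed.

Lemma cobdx_coef_neq0 i j v : v != kdeg b j -> cobdx_coef i j v != 0.
Proof. by apply: step_coef_neq0; lia. Qed.

Lemma cobdy_coef_neq0 i j u : u != kdeg a i -> cobdy_coef i j u != 0.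
Proof. by rewrite eq_sym; apply: step_coef_neq0; lia. Qed.

(* [y^v x^u] in position [(i, j)] has bidegree (u - kdeg a i, v - kdeg b j).   *)
(* The row through it is exact unless v = kdeg b j or u - kdeg a i = a - 1,    *)
(* and symmetrically for the columns.                                         *)
Definition row_exact i j u v := (v != kdeg b j) && (u != a.-1 + kdeg a i)%N.
Definition col_exact i j u v := (u != kdeg a i) && (v != b.-1 + kdeg b j)%N.

Lemma row_exact_x i j u v : row_exact i.+1 j (u + kstep a i) v = row_exact i j u v.
Proof. by rewrite /row_exact /= addnA eqn_add2r. Qed.

Lemma row_exact_y i j u v : row_exact i j.+1 u (v + kstep b j) = row_exact i j u v.
Proof. by rewrite /row_exact /= eqn_add2r. Qed.

Lemma col_exact_x i j u v : col_exact i.+1 j (u + kstep a i) v = col_exact i j u v.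
Proof. by rewrite /col_exact /= eqn_add2r. Qed.

Lemma col_exact_y i j u v : col_exact i j.+1 u (v + kstep b j) = col_exact i j u v.
Proof. by rewrite /col_exact /= addnA eqn_add2r. Qed.

(** Inverts the x-coefficient where the row is exact and otherwise, where the column is exact, the
    y-coefficient; the sign is that of the y-part of [cobd]. *)
Definition cobd_htpy (g : nat -> nat -> nat -> nat -> k) i j u v : k :=
  if row_exact i j u v then
    if (u + kstep a i < a)%N then (cobdx_coef i j v)^-1 * g i.+1 j (u + kstep a i)%N v
    else 0
  else if col_exact i j u v then
    if (v + kstep b j < b)%N
    then (-1) ^+ i * ((cobdy_coef i j u)^-1 * g i j.+1 u (v + kstep b j)%N)
    else 0
  else 0.

(** The monomials in no exact row or column, which will represent a basis of the cohomology: 1 and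
    y^(b-1) x^(a-1) in position (0, 0), x in (1, 0), y in (0, 1) and yx in (1, 1). *)
Definition harmonic (p : nat * nat * nat * nat) := p \in
  [:: (0, 0, 0, 0); (0, 0, a.-1, b.-1); (1, 0, 1, 0); (0, 1, 0, 1); (1, 1, 1, 1)]%N.

Lemma harmonicP i j u v : (u < a)%N -> (v < b)%N ->
  ~~ row_exact i j u v -> ~~ col_exact i j u v -> harmonic (i, j, u, v).
Proof.
move=> ua vb; rewrite /row_exact /col_exact !negb_and !negbK => /orP hx /orP hy.
(* Each case is contradictory or bounds [kdeg a i], and likewise [kdeg b j], which leaves i and j at
   most 1. *)
have ia : (kdeg a i < a)%N by case: hx hy => [/eqP hx|/eqP hx] [/eqP hy|/eqP hy]; lia.
have jb : (kdeg b j < b)%N by case: hx hy => [/eqP hx|/eqP hx] [/eqP hy|/eqP hy]; lia.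
have := kdeg_lt a2 ia; have := kdeg_lt b2 jb; move: hx hy {ia jb}.
rewrite /harmonic !inE !xpair_eqE.
case: i => [|[|//]]; case: j => [|[|//]] /= hx hy _ _;
  case: hx hy => [/eqP hx|/eqP hx] [/eqP hy|/eqP hy]; rewrite /kstep /= in hx hy *; lia.
Qed.

(** On a monomial hit by the inverted map, the homotopy divides by the coefficient. On a source of
    that map, the cocycle equation one step further determines the coefficient of [g]. *)
Lemma cobd_htpyP g :
    (forall i j u v, (u < a)%N -> (v < b)%N -> cobd g i j u v = 0) ->
    (forall i j u v, harmonic (i, j, u, v) -> g i j u v = 0) ->
  forall i j u v, (u < a)%N -> (v < b)%N -> cobd (cobd_htpy g) i j u v = g i j u v.
Proof.
move=> gZ gH i j u v ua vb.
have aP := @prev_termP a _ _ (ltnW a2); have bP := @prev_termP b _ _ (ltnW b2).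
have ss l : (-1) ^+ l * (-1) ^+ l = 1 :> k by rewrite -expr2 sqrr_sign.
have [xe|xe] := boolP (row_exact i j u v).
  case: (aP i u ua) => [[i' [u' [ei eu lt]]]|[px0 lt]].
    subst i u; move: (xe); rewrite row_exact_x => xe'.
    rewrite /cobd prev_termS [cobd_htpy g i' _ _ _]/cobd_htpy xe' ua.
    rewrite mulVKf ?cobdx_coef_neq0 //; last by case/andP: xe'.
    (* One further x-step leaves the box, so the homotopy at the y-predecessor is zero. *)
    case: (bP j v vb) => [[j' [v' [ej ev _]]]|[-> _]]; last by rewrite mulr0 addr0.
    subst j v; rewrite prev_termS /cobd_htpy -row_exact_y xe ltnNge lt /=.
    by rewrite !mulr0 addr0.
  case: lt => [lt|eu]; last by move: xe; rewrite /row_exact eu eqxx andbF.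
  (* The monomial is a source in its row: the cocycle equation after one x-step is compared with the
     y-part through [cobdx_cobdy]. *)
  have := gZ i.+1 j (u + kstep a i)%N v lt vb.
  rewrite /cobd px0 prev_termS add0r exprS mulN1r mulNr.
  have c0 : cobdx_coef i j v != 0 by apply: cobdx_coef_neq0; case/andP: xe.
  case: (bP j v vb) => [[j' [v' [ej ev _]]]|[py0 _]]; last first.
    rewrite !py0 !mulr0 subr0 => /eqP; rewrite mulf_eq0 (negbTE c0) /=.
    by move/eqP.
  subst j v; rewrite !prev_termS /cobd_htpy -row_exact_y xe lt.
  have c2 : cobdx_coef i j' v' != 0.
    by apply: cobdx_coef_neq0; move: xe; rewrite row_exact_y => /andP[].
  move/eqP; rewrite subr_eq0 => /eqP gE; apply: (mulfI c0); rewrite gE.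
  rewrite mulrCA; congr (_ * _); rewrite !mulrA; congr (_ * _).
  by rewrite -[RHS](mulKf c2) cobdx_cobdy; field.
have [ye|ye] := boolP (col_exact i j u v); last first.
  rewrite gH; last exact: harmonicP.
  (* Exactness depends only on the bidegree, so the homotopy also vanishes at both predecessors. *)
  have xpart : prev_term a i u (fun i' u' => cobdx_coef i' j v * cobd_htpy g i' j u' v) = 0.
    case: (aP i u ua) => [[i' [u' [ei eu _]]]|[-> //]].
    subst i u; rewrite prev_termS /cobd_htpy -row_exact_x (negbTE xe).
    by rewrite -col_exact_x (negbTE ye) mulr0.
  have ypart : prev_term b j v (fun j' v' => cobdy_coef i j' u * cobd_htpy g i j' u v') = 0.
    case: (bP j v vb) => [[j' [v' [ej ev _]]]|[-> //]].
    subst j v; rewrite prev_termS /cobd_htpy -row_exact_y (negbTE xe).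
    by rewrite -col_exact_y (negbTE ye) mulr0.
  by rewrite /cobd xpart ypart mulr0 addr0.
(* The column is exact but the row is not: the same argument with x and y exchanged. *)
case: (bP j v vb) => [[j' [v' [ej ev lt]]]|[py0 lt]].
  subst j v; move: (ye); rewrite col_exact_y => ye'.
  rewrite /cobd prev_termS [cobd_htpy g i j' _ _]/cobd_htpy -row_exact_y (negbTE xe) ye' vb.
  have c0 : cobdy_coef i j' u != 0 by apply: cobdy_coef_neq0; case/andP: ye'.
  rewrite [X in _ + _ * X = _]mulrCA [X in _ + X = _]mulrA ss mul1r mulVKf //.
  case: (aP i u ua) => [[i' [u' [ei eu _]]]|[-> _]]; last by rewrite add0r.
  subst i u; rewrite prev_termS /cobd_htpy -row_exact_x (negbTE xe) -col_exact_x ye ltnNge lt /=.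
  by rewrite mulr0 add0r.
case: lt => [lt|ev]; last by move: ye; rewrite /col_exact ev eqxx andbF.
have := gZ i j.+1 u (v + kstep b j)%N ua lt.
rewrite /cobd py0 prev_termS mulr0 addr0.
have c0 : cobdy_coef i j u != 0 by apply: cobdy_coef_neq0; case/andP: ye.
case: (aP i u ua) => [[i' [u' [ei eu _]]]|[px0 _]]; last first.
  rewrite !px0 add0r => /eqP; rewrite !mulf_eq0 (negbTE c0) signr_eq0 /=.
  by move/eqP.
subst i u; rewrite !prev_termS /cobd_htpy -row_exact_x (negbTE xe) -col_exact_x ye lt.
have c2 : cobdy_coef i' j u' != 0.
  by apply: cobdy_coef_neq0; move: ye; rewrite col_exact_x => /andP[].
move=> gE; apply: (mulfI c0).
transitivity ((-1) ^+ i' * (cobdx_coef i' j.+1 (v + kstep b j)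
    * g i' j.+1 u' (v + kstep b j)%N)).
  by rewrite mulrA [cobdy_coef i'.+1 _ _ * _]mulrC cobdx_cobdy; field.
move: gE; rewrite exprS mulN1r mulNr => /eqP; rewrite subr_eq0 => /eqP ->.
by rewrite mulrA ss mul1r.
Qed.

(** Wherever there is an incoming map, its coefficient is a difference of two equal powers of q. *)
Lemma cobd_harmonic g i j u v : harmonic (i, j, u, v) -> cobd g i j u v = 0.
Proof.
rewrite /harmonic !inE !xpair_eqE => /or4P[||| /orP[]];
  move=> /andP[/andP[/andP[/eqP-> /eqP->] /eqP->] /eqP->];
  rewrite /cobd /prev_term ?subnn ?mulr0 ?addr0 //=
    /cobdx_coef /cobdy_coef /step_coef /= /kstep /= ?subnn.
- by rewrite subrr mul0r.
- by rewrite subrr mul0r mulr0 addr0.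
- by rewrite !subrr !mul0r mulr0 addr0.
Qed.

(** Every map leaving a harmonic monomial has coefficient zero or takes it out of the box. *)
Lemma cobd_harmonic_supp g i j u v :
    (forall i j u v, ~~ harmonic (i, j, u, v) -> g i j u v = 0) ->
    (u < a)%N -> (v < b)%N ->
  cobd g i j u v = 0.
Proof.
move=> gH ua vb; rewrite /cobd.
have -> : prev_term a i u (fun i' u' => cobdx_coef i' j v * g i' j u' v) = 0.
  case: (prev_termP i (ltnW a2) ua) => [[i' [u' [ei eu _]]]|[-> //]].
  subst i u; rewrite prev_termS.
  have [|/gH->] := boolP (harmonic (i', j, u', v)); last by rewrite mulr0.
  rewrite /harmonic !inE !xpair_eqE => /or4P[||| /orP[]];
    move=> /andP[/andP[/andP[/eqP ei /eqP ej] /eqP eu] /eqP ev]; subst i' j u' v;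
    rewrite /kstep /= in ua *; try lia.
  - by rewrite /cobdx_coef /step_coef /= subrr mul0r.
  - by rewrite /cobdx_coef /step_coef /= /kstep /= subrr mul0r.
have -> : prev_term b j v (fun j' v' => cobdy_coef i j' u * g i j' u v') = 0.
  case: (prev_termP j (ltnW b2) vb) => [[j' [v' [ej ev _]]]|[-> //]].
  subst j v; rewrite prev_termS.
  have [|/gH->] := boolP (harmonic (i, j', u, v')); last by rewrite mulr0.
  rewrite /harmonic !inE !xpair_eqE => /or4P[||| /orP[]];
    move=> /andP[/andP[/andP[/eqP ei /eqP ej] /eqP eu] /eqP ev]; subst i j' u v';
    rewrite /kstep /= in vb *; try lia.
  - by rewrite /cobdy_coef /step_coef /= subrr mul0r.
  - by rewrite /cobdy_coef /step_coef /= /kstep /= subrr mul0r.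
by rewrite mulr0 addr0.
Qed.

End KoszulCochains.

(** * The bimodule resolution and its cohomology *)

(* All that is used about the algebra [env A] and its pure tensors. *)
Record enveloping (k : comNzRingType) (A E : algType k) (t : A -> A -> E) : Prop :=
  Enveloping {
    env_bilin : bilin t;
    env_tensM : forall l r l' r', t l r * t l' r' = t (l * l') (r' * r);
    env_tens1 : t 1 1 = 1;
    env_lift : forall (V : lmodType k) (f : A -> A -> V), bilin f ->
      exists g : {linear E -> V}, forall l r, g (t l r) = f l r;
    env_ext : forall (V : lmodType k) (f g : {linear E -> V}),
      (forall l r, f (t l r) = g (t l r)) -> f =1 g }.

Section Enveloping.
Variables (k : comNzRingType) (A E : algType k) (t : A -> A -> E).
Hypothesis envE : enveloping t.
Implicit Types (l r : A) (c : k).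

Lemma linear_scale0 (V W : lmodType k) (f : V -> W) : linear f ->
  (forall c v, f (c *: v) = c *: f v) /\ f 0 = 0.
Proof.
move=> fl; have f0 : f 0 = 0.
  by have := fl (-1) 0 0; rewrite scaler0 addr0 scaleN1r addNr.
by split=> // c v; have := fl c v 0; rewrite !addr0 f0 addr0.
Qed.

Lemma env_tensZl c l r : t (c *: l) r = c *: t l r.
Proof. exact: (linear_scale0 ((env_bilin envE).1 r)).1. Qed.

Lemma env_tensZr c l r : t l (c *: r) = c *: t l r.
Proof. exact: (linear_scale0 ((env_bilin envE).2 l)).1. Qed.

Lemma env_tens0l r : t 0 r = 0.
Proof. exact: (linear_scale0 ((env_bilin envE).1 r)).2. Qed.

Lemma env_tens0r l : t l 0 = 0.
Proof. exact: (linear_scale0 ((env_bilin envE).2 l)).2. Qed.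

Lemma env_tens_suml (I : Type) (s : seq I) (P : pred I) (f : I -> A) r :
  t (\sum_(i <- s | P i) f i) r = \sum_(i <- s | P i) t (f i) r.
Proof.
apply: (big_morph (t^~ r)) => [l l'|]; last exact: env_tens0l.
by have := (env_bilin envE).1 r 1 l l'; rewrite !scale1r.
Qed.

Lemma env_tens_sumr (I : Type) (s : seq I) (P : pred I) l (f : I -> A) :
  t l (\sum_(i <- s | P i) f i) = \sum_(i <- s | P i) t l (f i).
Proof.
apply: (big_morph (t l)) => [r r'|]; last exact: env_tens0r.
by have := (env_bilin envE).2 l 1 r r'; rewrite !scale1r.
Qed.

(** These are the left E-linear maps from E to E; k-linearity is what is recorded, since they are
    composed with contractions that are k-linear only. *)
Definition env_mulr (d : E) (z : E) : E := z * d.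

Lemma env_mulr_linear d : linear (env_mulr d).
Proof. by move=> c z z'; rewrite /env_mulr mulrDl scalerAl. Qed.

HB.instance Definition _ d :=
  GRing.isLinear.Build k E E *:%R (env_mulr d) (env_mulr_linear d).

End Enveloping.

Section Koszul.
Variables (k : fieldType) (q : k) (a b : nat) (A : algType k) (x y : A).
Variable cf : nat -> nat -> {linear A -> k^o}.
Variables (E : algType k) (tens : A -> A -> E).
Hypothesis mbA : monomial_basis q a b x y cf.
Hypothesis envE : enveloping tens.

(* [kmon i j u u' v v'] is x^u e_i x^u' y^v f_j y^v' written in terms of the  *)
(* free generator e_i f_j, where e_i has x-degree [kdeg a i], f_j has         *)
(* y-degree [kdeg b j], and elements of x-degree m and y-degree n commute up  *)
(* to q^(m n).                                                                *)
Definition kmon i j u u' v v' : E :=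
  q ^+ ((u + u' + kdeg a i) * v + u' * (kdeg b j + v'))
    *: tens (y ^+ v * x ^+ u) (y ^+ v' * x ^+ u').

(** The powers of q in [kmon] are chosen so that no scalar appears and exponents simply add up. *)
Lemma kmonMx i j u u' v v' s s' : (s + s' = kstep a i)%N ->
  kmon i.+1 j u u' v v' * kmon i j s s' 0 0
    = kmon i j (u + s) (u' + s') v v'.
Proof.
move=> ss'; rewrite /kmon -scalerAl -scalerAr scalerA (env_tensM envE).
rewrite !expr0 !mul1r -[_ * x ^+ s]mulrA -exprD [x ^+ s' * _]mulrA.
rewrite (mulr_xX_yX (mb_comm mbA)) -scalerAl -[_ * x ^+ u']mulrA -exprD.
rewrite (env_tensZr envE) scalerA -!exprD.
rewrite [(s' + u')%N]addnC; congr (_ *: _); congr (_ ^+ _).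
by rewrite /= -ss'; ring.
Qed.

Lemma kmonMy i j u u' v v' t t' : (t + t' = kstep b j)%N ->
  kmon i j.+1 u u' v v' * kmon i j 0 0 t t'
    = kmon i j u u' (v + t) (v' + t').
Proof.
move=> tt'; rewrite /kmon -scalerAl -scalerAr scalerA (env_tensM envE).
rewrite !expr0 !mulr1 [y ^+ t' * _]mulrA -exprD -[_ * y ^+ t]mulrA.
rewrite (mulr_xX_yX (mb_comm mbA)) -scalerAr [y ^+ v * _]mulrA -exprD.
rewrite (env_tensZl envE) scalerA -!exprD.
rewrite [(t' + v')%N]addnC; congr (_ *: _); congr (_ ^+ _).
by rewrite /= -tt'; ring.
Qed.

Lemma mb_x0 u : (a <= u)%N -> x ^+ u = 0.
Proof. by move/subnKC <-; rewrite exprD (mb_xa mbA) mul0r. Qed.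

Lemma mb_y0 v : (b <= v)%N -> y ^+ v = 0.
Proof. by move/subnKC <-; rewrite exprD (mb_yb mbA) mul0r. Qed.

Lemma kmon_boxedx i j v v' : boxed a (fun u u' => kmon i j u u' v v').
Proof.
move=> u u' /orP[/mb_x0|/mb_x0] e; rewrite /kmon e !mulr0.
  by rewrite (env_tens0l envE) scaler0.
by rewrite (env_tens0r envE) scaler0.
Qed.

Lemma kmon_boxedy i j u u' : boxed b (fun v v' => kmon i j u u' v v').
Proof.
move=> v v' /orP[/mb_y0|/mb_y0] e; rewrite /kmon e !mul0r.
  by rewrite (env_tens0l envE) scaler0.
by rewrite (env_tens0r envE) scaler0.
Qed.

Definition kDx i j : E := kdiff a i (fun s s' => kmon i j s s' 0 0) 0 0.
Definition kDy i j : E := kdiff b j (fun t t' => kmon i j 0 0 t t') 0 0.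

Definition kdx i j := env_mulr (kDx i j).
Definition kdy i j := env_mulr (kDy i j).
HB.instance Definition _ i j := GRing.Linear.on (kdx i j).
HB.instance Definition _ i j := GRing.Linear.on (kdy i j).

Lemma kdx_mon i j u u' v v' : kdx i j (kmon i.+1 j u u' v v') =
  kdiff a i (fun s s' => kmon i j s s' v v') u u'.
Proof.
rewrite /kdx /env_mulr /kDx /kdiff; case: ifP => oi.
  rewrite mulr_sumr; apply: eq_bigr => t _; rewrite kmonMx //.
  by rewrite /kstep oi; have := ltn_ord t; lia.
by rewrite mulrBr !kmonMx ?addn0 ?addn1 // /kstep oi.
Qed.

Lemma kdy_mon i j u u' v v' : kdy i j (kmon i j.+1 u u' v v') =
  kdiff b j (fun t t' => kmon i j u u' t t') v v'.
Proof.
rewrite /kdy /env_mulr /kDy /kdiff; case: ifP => oj.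
  rewrite mulr_sumr; apply: eq_bigr => t _; rewrite kmonMy //.
  by rewrite /kstep oj; have := ltn_ord t; lia.
by rewrite mulrBr !kmonMy ?addn0 ?addn1 // /kstep oj.
Qed.

(** A composite of right multiplications is determined by the image of the generator, where the
    untwisted identity applies. *)
Lemma kdx_kdx i j z : kdx i j (kdx i.+1 j z) = 0.
Proof.
rewrite /kdx /env_mulr -mulrA -[_ * kDx i j]/(kdx i j (kDx i.+1 j)).
rewrite raddf_kdiff (@eq_kdiff _ _ _ _ _ _ _ (fun s s' => kdx_mon i j s s' 0 0)).
by rewrite kdiff_kdiff ?mulr0 //; exact: kmon_boxedx.
Qed.

Lemma kdy_kdy i j z : kdy i j (kdy i j.+1 z) = 0.
Proof.
rewrite /kdy /env_mulr -mulrA -[_ * kDy i j]/(kdy i j (kDy i j.+1)).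
rewrite raddf_kdiff (@eq_kdiff _ _ _ _ _ _ _ (fun t t' => kdy_mon i j 0 0 t t')).
by rewrite kdiff_kdiff ?mulr0 //; exact: kmon_boxedy.
Qed.

Lemma kdx_kdy i j z : kdx i j (kdy i.+1 j z) = kdy i j (kdx i j.+1 z).
Proof.
rewrite /kdx /kdy /env_mulr -!mulrA; congr (_ * _).
rewrite -[LHS]/(kdx i j (kDy i.+1 j)) -[RHS]/(kdy i j (kDx i j.+1)).
rewrite !raddf_kdiff.
rewrite (@eq_kdiff _ _ _ _ _ _ _ (fun t t' => kdx_mon i j 0 0 t t')).
rewrite (@eq_kdiff _ _ _ _ _ _ _ (fun s s' => kdy_mon i j s s' 0 0)).
by rewrite kdiffC.
Qed.

(** * Contraction of the bimodule complex *)

Hypothesis q0 : q != 0.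

Lemma kext_exists (V : lmodType k) i j (f : nat -> nat -> nat -> nat -> V) :
    (forall v v', boxed a (fun u u' => f u u' v v')) ->
    (forall u u', boxed b (fun v v' => f u u' v v')) ->
  exists g : {linear E -> V}, forall u u' v v',
    g (kmon i j u u' v v') = f u u' v v'.
Proof.
move=> fx fy.
pose w u u' v v' := (u + u' + kdeg a i) * v + u' * (kdeg b j + v').
(* The factor q^(-w) undoes the normalisation in [kmon]. *)
pose g l r := \sum_(u < a) \sum_(v < b) \sum_(u' < a) \sum_(v' < b)
  (q ^- w u u' v v' * cf u v l * cf u' v' r) *: f u u' v v'.
have cfP u v c l l' : cf u v (c *: l + l') = c * cf u v l + cf u v l' :> k.
  exact: linearP.
have gb : bilin g.
  split=> [r c l l'|l c r r']; rewrite /g.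
    do 4![rewrite scaler_sumr -big_split /=; apply: eq_bigr => ? _].
    by rewrite cfP scalerA -scalerDl; congr (_ *: _); ring.
  do 4![rewrite scaler_sumr -big_split /=; apply: eq_bigr => ? _].
  by rewrite cfP scalerA -scalerDl; congr (_ *: _); ring.
have [h hE] := env_lift envE gb; exists h => s s' t t'.
have [sa|sa] := ltnP s a; last by rewrite fx ?sa // kmon_boxedx ?sa // linear0.
have [sa'|sa'] := ltnP s' a; last first.
  by rewrite fx ?sa' ?orbT // kmon_boxedx ?sa' ?orbT // linear0.
have [tb|tb] := ltnP t b; last by rewrite fy ?tb // kmon_boxedy ?tb // linear0.
have [tb'|tb'] := ltnP t' b; last first.
  by rewrite fy ?tb' ?orbT // kmon_boxedy ?tb' ?orbT // linear0.
rewrite /kmon linearZ hE /g -/(w s s' t t').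
rewrite (bigD1 (Ordinal sa)) //= [X in _ + X]big1 ?addr0 => [|u]; last first.
  rewrite -val_eqE /= => us; do 3![apply: big1 => ? _].
  by rewrite (mb_dual mbA) // (negbTE us) mulr0 mul0r scale0r.
rewrite (bigD1 (Ordinal tb)) //= [X in _ + X]big1 ?addr0 => [|v]; last first.
  rewrite -val_eqE /= => vt; do 2![apply: big1 => ? _].
  by rewrite (mb_dual mbA) // (negbTE vt) andbF mulr0 mul0r scale0r.
rewrite (bigD1 (Ordinal sa')) //= [X in _ + X]big1 ?addr0 => [|u]; last first.
  rewrite -val_eqE /= => us; apply: big1 => ? _.
  by rewrite [cf u _ _](mb_dual mbA) // (negbTE us) mulr0 scale0r.
rewrite (bigD1 (Ordinal tb')) //= [X in _ + X]big1 ?addr0 => [|v]; last first.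
  rewrite -val_eqE /= => vt.
  by rewrite [cf _ v _](mb_dual mbA) // (negbTE vt) andbF mulr0 scale0r.
rewrite !(mb_dual mbA) // !eqxx !mulr1 scalerA mulfV ?scale1r //.
by rewrite expf_neq0.
Qed.

Lemma env_ext_kmon (V : lmodType k) i j (f g : {linear E -> V}) :
    (forall u u' v v', f (kmon i j u u' v v') = g (kmon i j u u' v v')) ->
  f =1 g.
Proof.
move=> fg; apply: (env_ext envE) => l r.
have e u u' v v' : f (tens (y ^+ v * x ^+ u) (y ^+ v' * x ^+ u'))
      = g (tens (y ^+ v * x ^+ u) (y ^+ v' * x ^+ u')).
  have := fg u u' v v'; rewrite /kmon !linearZ => /scalerI; apply.
  by rewrite expf_neq0.
rewrite (mb_span mbA l) (mb_span mbA r) (env_tens_suml envE) !linear_sum.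
apply: eq_bigr => u _; rewrite (env_tens_suml envE) !linear_sum.
apply: eq_bigr => v _; rewrite (env_tens_sumr envE) !linear_sum.
apply: eq_bigr => u' _; rewrite (env_tens_sumr envE) !linear_sum.
apply: eq_bigr => v' _.
by rewrite (env_tensZl envE) (env_tensZr envE) !linearZ /= e.
Qed.

Hypotheses (a2 : (2 <= a)%N) (b2 : (2 <= b)%N).

Let a0 : (0 < a)%N := ltnW a2.
Let b0 : (0 < b)%N := ltnW b2.

Local Notation koszul_diff := (tot_diff (fun i j => kdx i j : {linear E -> E})
                                   (fun i j => kdy i j : {linear E -> E})).

Let bx i j v v' : boxed a (fun u u' => kmon i j u u' v v').
Proof. exact: kmon_boxedx. Qed.
Let bY i j u u' : boxed b (fun v v' => kmon i j u u' v v').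
Proof. exact: kmon_boxedy. Qed.

Lemma koszul_diff_diag n f : on_diag n.+1 f -> on_diag n (koszul_diff f).
Proof.
move=> fd i j ij; rewrite /tot_diff !fd ?addSn ?addnS ?eqSS //.
by rewrite !linear0 ?scaler0 addr0.
Qed.

Lemma koszul_diff_diff f i j : koszul_diff (koszul_diff f) i j = 0.
Proof.
apply: tot_diff_diff => {}i {}j z; first exact: kdx_kdx.
  exact: kdy_kdy.
exact: kdx_kdy.
Qed.

(** The contractions in x and y are defined on the [kmon], where the identities of the two factors
    hold verbatim, and [tot_htpy] assembles them. Being k-linear suffices, as exactness concerns
    underlying sets. *)
Lemma koszul_contraction (aug : {linear E -> A}) :
    (forall l r, aug (tens l r) = l * r) ->
  exists h : (nat -> nat -> E) -> nat -> nat -> E,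
    (forall n f, on_diag n f -> on_diag n.+1 (h f)) /\
    (forall f, (forall i j, koszul_diff f i j = 0) -> aug (f 0%N 0%N) = 0 ->
       forall i j, koszul_diff (h f) i j = f i j).
Proof.
move=> augE.
have [sx sxE] : exists sx : nat -> nat -> {linear E -> E},
    forall i j u u' v v', sx i j (kmon i j u u' v v')
      = khtpy a i (fun s s' => kmon i.+1 j s s' v v') u u'.
  have H i j := kext_exists i j
    (fun v v' => boxed_khtpy i (bx i.+1 j v v'))
    (fun u u' => boxed_khtpy_arg a i u u' (bY i.+1 j)).
  have [s sE] := choice (fun p : nat * nat => H p.1 p.2).
  by exists (fun i j => s (i, j)) => i j; exact: (sE (i, j)).
have [px pxE] : exists px : nat -> {linear E -> E},
    forall j u u' v v', px j (kmon 0 j u u' v v')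
      = kproj a (fun s s' => kmon 0 j s s' v v') u u'.
  have H j := kext_exists 0 j
    (fun v v' => boxed_kproj (bx 0 j v v'))
    (fun u u' => boxed_kproj_arg a u u' (bY 0 j)).
  by have [s sE] := choice H; exists s.
have [sy syE] : exists sy : nat -> {linear E -> E},
    forall j u u' v v', sy j (kmon 0 j u u' v v')
      = khtpy b j (fun t t' => kmon 0 j.+1 u u' t t') v v'.
  have H j := kext_exists 0 j
    (fun v v' => boxed_khtpy_arg b j v v'
       (F := fun t t' u u' => kmon 0 j.+1 u u' t t') (bx 0 j.+1))
    (fun u u' => boxed_khtpy j (bY 0 j.+1 u u')).
  by have [s sE] := choice H; exists s.
have [py pyE] : exists py : {linear E -> E},
    forall u u' v v', py (kmon 0 0 u u' v v')
      = kproj b (fun t t' => kmon 0 0 u u' t t') v v'.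
  have H := kext_exists 0 0
    (fun v v' => boxed_kproj_arg b v v'
       (F := fun t t' u u' => kmon 0 0 u u' t t') (bx 0 0))
    (fun u u' => boxed_kproj (bY 0 0 u u')).
  exact: H.
have ext := env_ext_kmon.
have dxsx0 j z : kdx 0 j (sx 0 j z) = z - px j z.
  apply: (ext _ 0 j (kdx 0 j \o sx 0 j) (idfun \- px j)) => u u' v v' /=.
  rewrite sxE raddf_khtpy (@eq_khtpy _ _ _ _ _ _ _ (fun s s' => kdx_mon 0 j s s' v v')).
  by rewrite khtpy0_kdiff0 // pxE.
have dxsx i j z : kdx i.+1 j (sx i.+1 j z) + sx i j (kdx i j z) = z.
  apply: (ext _ i.+1 j ((kdx i.+1 j \o sx i.+1 j) \+ (sx i j \o kdx i j)) idfun).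
  move=> u u' v v' /=; rewrite sxE raddf_khtpy.
  rewrite (@eq_khtpy _ _ _ _ _ _ _ (fun s s' => kdx_mon i.+1 j s s' v v')).
  rewrite kdx_mon raddf_kdiff.
  rewrite (@eq_kdiff _ _ _ _ _ _ _ (fun s s' => sxE i j s s' v v')).
  exact: khtpy_kdiff.
have pxdx j z : px j (kdx 0 j z) = 0.
  apply: (ext _ 1 j (px j \o kdx 0 j) \0) => u u' v v' /=.
  rewrite kdx_mon raddf_kdiff.
  rewrite (@eq_kdiff _ _ _ _ _ _ _ (fun s s' => pxE j s s' v v')).
  exact: kdiff0_kproj.
have sxdy i j z : kdy i.+1 j (sx i j.+1 z) = sx i j (kdy i j z).
  apply: (ext _ i j.+1 (kdy i.+1 j \o sx i j.+1) (sx i j \o kdy i j)) => u u' v v' /=.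
  rewrite sxE raddf_khtpy kdy_mon raddf_kdiff.
  rewrite (@eq_khtpy _ _ _ _ _ _ _ (fun s s' => kdy_mon i.+1 j s s' v v')).
  rewrite (@eq_kdiff _ _ _ _ _ _ _ (fun t t' => sxE i j u u' t t')).
  exact: khtpy_kdiffC.
have pxdy j z : kdy 0 j (px j.+1 z) = px j (kdy 0 j z).
  apply: (ext _ 0 j.+1 (kdy 0 j \o px j.+1) (px j \o kdy 0 j)) => u u' v v' /=.
  rewrite pxE raddf_kproj kdy_mon raddf_kdiff.
  rewrite (@eq_kdiff _ _ _ _ _ _ _ (fun t t' => pxE j u u' t t')).
  rewrite -kproj_kdiffC /kproj; case: ifP => // _.
  exact: kdy_mon.
have dysy0 z : kdy 0 0 (sy 0 z) = z - py z.
  apply: (ext _ 0 0 (kdy 0 0 \o sy 0) (idfun \- py)) => u u' v v' /=.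
  rewrite syE raddf_khtpy.
  rewrite (@eq_khtpy _ _ _ _ _ _ _ (fun t t' => kdy_mon 0 0 u u' t t')).
  by rewrite khtpy0_kdiff0 // pyE.
have dysy j z : kdy 0 j.+1 (sy j.+1 z) + sy j (kdy 0 j z) = z.
  apply: (ext _ 0 j.+1 ((kdy 0 j.+1 \o sy j.+1) \+ (sy j \o kdy 0 j)) idfun).
  move=> u u' v v' /=; rewrite syE raddf_khtpy.
  rewrite (@eq_khtpy _ _ _ _ _ _ _ (fun t t' => kdy_mon 0 j.+1 u u' t t')).
  rewrite kdy_mon raddf_kdiff.
  rewrite (@eq_kdiff _ _ _ _ _ _ _ (fun t t' => syE j u u' t t')).
  exact: khtpy_kdiff.
pose t1 : {linear A -> E} := HB.pack (tens 1)
  (GRing.isLinear.Build k A E *:%R (tens 1) ((env_bilin envE).2 1)).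
(* What the contraction leaves at the origin is the augmentation followed by r to [tens 1 r], so it
   vanishes on the kernel of [aug]. *)
have pypx z : py (px 0%N z) = t1 (aug z).
  apply: (ext _ 0 0 (py \o px 0) (t1 \o aug)) => u u' v v' /=.
  rewrite pxE raddf_kproj /kproj.
  rewrite {2}/kmon linearZ /= augE.
  case: ltnP => ua; last first.
    by rewrite (mb_x0 ua) mulr0 mul0r scaler0 (env_tens0r envE).
  rewrite pyE /kproj; case: ltnP => vb; last first.
    by rewrite (mb_y0 vb) !mul0r scaler0 (env_tens0r envE).
  rewrite /kmon -mulrA [x ^+ u * _]mulrA (mulr_xX_yX (mb_comm mbA)).
  rewrite -scalerAl -scalerAr -mulrA -exprD mulrA -exprD scalerA.
  rewrite (env_tensZr envE) -exprD !expr0 mulr1; congr (_ *: _); congr (_ ^+ _).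
  by rewrite /=; ring.
exists (tot_htpy sx px sy); split=> [n f fd i j|f f0 aug0 i j].
  case: i => [|i]; last by rewrite addSn eqSS => ij /=; rewrite fd ?linear0.
  by case: j => [|j] //=; rewrite add0n eqSS => ij; rewrite fd ?linear0.
have := tot_htpyP (dx := fun i j => kdx i j : {linear E -> E})
  (dy := fun i j => kdy i j : {linear E -> E})
  dxsx0 dxsx pxdx sxdy pxdy dysy0 dysy f i j.
rewrite pypx aug0 linear0 if_same subr0 => <-.
rewrite [X in _ = _ + X](_ : _ = 0) ?addr0 //.
by case: i => [|i] /=; [case: j => [|j] //=|]; rewrite f0 ?linear0.
Qed.

(** * The projective resolution of the bimodule *)

Variables (M : lmodType E) (phi : {additive M -> A}) (psi : A -> M).
Hypotheses (phiK : cancel phi psi) (psiK : cancel psi phi).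
Hypothesis phi_act : forall l r m, phi (tens l r *: m) = l * phi m * r.

Definition kres_diff_fun n (f : diagmod E n.+1) : diagmod E n :=
  diag_of n (koszul_diff (diag_at f)).

Lemma kres_diff_linear n : linear (@kres_diff_fun n).
Proof.
move=> c f g; apply: diagP => i j ij.
rewrite diag_at_linear !diag_ofK // /tot_diff !diag_at_linear.
rewrite /= /kdx /kdy /env_mulr !mulrDl scalerDr mulrDr addrACA -!mulrA.
by rewrite scalerAr.
Qed.

HB.instance Definition _ n := GRing.isLinear.Build E (diagmod E n.+1) (diagmod E n)
  *:%R (@kres_diff_fun n) (@kres_diff_linear n).

(** [phi] is only additive, but a scalar c acts as [tens (c *: 1) 1], which [phi_act] handles. *)
Lemma act_on_linear m : linear (fun z : E => phi (z *: m)).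
Proof.
move=> c z z'; rewrite scalerDl raddfD; congr (_ + _).
have -> : c *: z = tens (c *: 1) 1 * z.
  by rewrite (env_tensZl envE) (env_tens1 envE) -scalerAl mul1r.
by rewrite -scalerA phi_act mulr1 -scalerAl mul1r.
Qed.

Definition act_on m : {linear E -> A} :=
  HB.pack (fun z : E => phi (z *: m))
    (GRing.isLinear.Build k E A *:%R _ (act_on_linear m)).

Lemma phi_kmon m i j u u' v v' :
  phi (kmon i j u u' v v' *: m)
    = q ^+ ((u + u' + kdeg a i) * v + u' * (kdeg b j + v'))
        *: (y ^+ v * x ^+ u * phi m * (y ^+ v' * x ^+ u')).
Proof. by rewrite [LHS](linearZ_LR (act_on m)) [X in _ *: X]phi_act. Qed.

Definition kres_aug (f : diagmod E 0) : M := diag_at f 0 0 *: psi 1.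

Lemma kres_aug_linear : linear kres_aug.
Proof. by move=> c f g; rewrite /kres_aug diag_at_linear scalerDl scalerA. Qed.

HB.instance Definition _ := GRing.isLinear.Build E (diagmod E 0) M
  *:%R kres_aug kres_aug_linear.

Lemma act_on1_tens l r : act_on (psi 1) (tens l r) = l * r.
Proof. by rewrite /= phi_act psiK mulr1. Qed.

Lemma kres_aug_surj m : exists f, kres_aug f = m.
Proof.
exists (diag_of 0 (fun _ _ => tens (phi m) 1)); rewrite /kres_aug diag_ofK //.
by apply: (can_inj phiK); rewrite phi_act psiK !mulr1.
Qed.

Lemma kres_exact_lift n (f : diagmod E n) :
    (forall i j, koszul_diff (diag_at f) i j = 0) ->
    act_on (psi 1) (diag_at f 0 0) = 0 ->
  exists g, kres_diff_fun g = f.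
Proof.
move=> f0 aug0.
have [h [hd hP]] := koszul_contraction act_on1_tens.
exists (diag_of n.+1 (h (diag_at f))); apply: diagP => i j ij.
rewrite diag_ofK // -(hP _ f0 aug0 i j) /tot_diff.
by rewrite !diag_ofK ?addSn ?addnS ?ij.
Qed.

Lemma kres_diff_fun_diff n (f : diagmod E n.+2) :
  kres_diff_fun (kres_diff_fun f) = 0.
Proof.
apply: diagP => i j ij; rewrite diag_ofK // diag_at0.
rewrite -[RHS](koszul_diff_diff (diag_at f) i j) /tot_diff.
by rewrite !diag_ofK ?addSn ?addnS ?ij.
Qed.

Lemma kres_exact0 f :
  kres_aug f = 0 <-> exists g, kres_diff_fun g = f.
Proof.
split=> [f0|[g <-]].
  apply: kres_exact_lift => [i j|]; last by rewrite /= -[_ *: _]/(kres_aug f) f0 raddf0.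
  by rewrite /tot_diff /diag_at addSn addnS !linear0 ?scaler0 ?addr0.
have D0 D : act_on (psi 1) D = 0 -> D *: psi 1 = 0.
  by move=> D0; apply: (can_inj phiK); rewrite raddf0.
rewrite /kres_aug diag_ofK // /tot_diff expr0 scale1r scalerDl.
(* Applied to 1, left and right multiplication by x agree, and so do those by y. *)
rewrite /= /kdx /kdy /env_mulr -!scalerA !D0 ?scaler0 ?addr0 //.
  rewrite /kDy raddf_kdiff -[LHS]/(phi _ - phi _) !phi_kmon !psiK.
  by rewrite !(muln0, mul0n, addn0, add0n, expr0, expr1, mulr1, mul1r, scale1r) subrr.
rewrite /kDx raddf_kdiff -[LHS]/(phi _ - phi _) !phi_kmon !psiK.
by rewrite !(muln0, mul0n, addn0, add0n, expr0, expr1, mulr1, mul1r, scale1r) subrr.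
Qed.

Lemma kres_exactS n f :
  @kres_diff_fun n f = 0 <-> exists g, kres_diff_fun g = f.
Proof.
split=> [f0|[g <-]]; last exact: kres_diff_fun_diff.
apply: kres_exact_lift => [i j|]; last by rewrite /diag_at linear0.
have [ij|ij] := eqVneq (i + j)%N n.
  by have := congr1 (fun g => diag_at g i j) f0; rewrite diag_ofK // diag_at0.
by apply: koszul_diff_diag ij; exact: diag_atP.
Qed.

Definition kres : proj_resolution M :=
  ProjResolution (res_obj := diagmod E)
    (res_diff := fun n => @kres_diff_fun n : {linear _ -> _})
    (res_aug := kres_aug : {linear _ -> _})
    (fun n => @diagmod_projective E n) kres_aug_surj kres_exact0 kres_exactS.

(** * The differentials on monomials of A *)

Lemma phi_kDx i j m : phi (kDx i j *: m) =
  kdiff a i (fun s s' => q ^+ (s' * kdeg b j) *: (x ^+ s * phi m * x ^+ s')) 0 0.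
Proof.
rewrite -[LHS]/(act_on m (kDx i j)) raddf_kdiff; apply: eq_kdiff => s s'.
by rewrite [LHS]phi_kmon muln0 add0n addn0 !expr0 !mul1r.
Qed.

Lemma phi_kDy i j m : phi (kDy i j *: m) =
  kdiff b j (fun t t' => q ^+ (kdeg a i * t) *: (y ^+ t * phi m * y ^+ t')) 0 0.
Proof.
rewrite -[LHS]/(act_on m (kDy i j)) raddf_kdiff; apply: eq_kdiff => t t'.
by rewrite [LHS]phi_kmon mul0n addn0 !add0n !expr0 !mulr1.
Qed.

(** As s + s' is constantly [kstep a i], all terms are multiples of one monomial and their scalars
    add up. *)
Lemma kdiff_mon_x i j u v :
  kdiff a i (fun s s' => q ^+ (s' * kdeg b j) *:
      (x ^+ s * (y ^+ v * x ^+ u) * x ^+ s')) 0 0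
    = cobdx_coef q a b i j v *: (y ^+ v * x ^+ (u + kstep a i)).
Proof.
have T s s' : x ^+ s * (y ^+ v * x ^+ u) * x ^+ s'
    = q ^+ (s * v) *: (y ^+ v * x ^+ (u + (s + s'))).
  rewrite [x ^+ s * _]mulrA (mulr_xX_yX (mb_comm mbA)) -!scalerAl.
  by rewrite -!mulrA -!exprD [(u + (s + s'))%N]addnCA.
rewrite /kdiff /cobdx_coef /step_coef /kstep; case: ifP => _.
  rewrite scaler_suml; apply: eq_bigr => t _.
  rewrite T scalerA -!exprM -!exprD !add0n subnKC; last by have := ltn_ord t; lia.
  by congr (_ ^+ _ *: _); ring.
by rewrite !T !scalerA -!exprD -scalerBl !(mul0n, mul1n, add0n, addn0).
Qed.

Lemma kdiff_mon_y i j u v :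
  kdiff b j (fun t t' => q ^+ (kdeg a i * t) *:
      (y ^+ t * (y ^+ v * x ^+ u) * y ^+ t')) 0 0
    = cobdy_coef q a b i j u *: (y ^+ (v + kstep b j) * x ^+ u).
Proof.
have T t t' : y ^+ t * (y ^+ v * x ^+ u) * y ^+ t'
    = q ^+ (u * t') *: (y ^+ (v + (t + t')) * x ^+ u).
  rewrite -!mulrA (mulr_xX_yX (mb_comm mbA)) -!scalerAr !mulrA -!exprD.
  by rewrite [(v + (t + t'))%N]addnCA addnA.
rewrite /kdiff /cobdy_coef /step_coef /kstep; case: ifP => _.
  rewrite scaler_suml; apply: eq_bigr => t _.
  rewrite T scalerA -!exprM -!exprD !add0n subnKC //; have := ltn_ord t; lia.
by rewrite !T !scalerA -!exprD -scalerBl !(muln0, muln1, add0n, addn0).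
Qed.

Lemma mb_dual_box u v s t : (u < a)%N -> (v < b)%N ->
  cf u v (y ^+ t * x ^+ s) = ((u == s) && (v == t))%:R.
Proof.
move=> ua vb.
have [sa|sa] := ltnP s a; last first.
  by rewrite (mb_x0 sa) mulr0 linear0; case: eqP => // us; lia.
have [tb|tb] := ltnP t b; last first.
  by rewrite (mb_y0 tb) mul0r linear0 [v == t]ltn_eqF ?andbF //; lia.
exact: (mb_dual mbA).
Qed.

Lemma cf_sum e f u v (G : nat -> nat -> k) : (u < a)%N -> (v < b)%N ->
  cf u v (\sum_(s < a) \sum_(t < b) G s t *: (y ^+ (t + f) * x ^+ (s + e)))
    = if (e <= u)%N && (f <= v)%N then G (u - e)%N (v - f)%N else 0.
Proof.
move=> ua vb.
have cfE s t c : cf u v (c *: (y ^+ (t + f) * x ^+ (s + e)))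
    = c * ((u == s + e)%N && (v == t + f)%N)%:R.
  by rewrite linearZ /= mb_dual_box.
case: ifP => [/andP[eu fv]|nle]; last first.
  rewrite linear_sum big1 // => s _; rewrite linear_sum big1 // => t _.
  rewrite cfE (_ : _ && _ = false) ?mulr0 //; apply: contraFF nle.
  by move=> /andP[/eqP-> /eqP->]; rewrite !leq_addl.
have ua' : (u - e < a)%N by lia.
have vb' : (v - f < b)%N by lia.
rewrite linear_sum (bigD1 (Ordinal ua')) //= [X in _ + X]big1 => [|s].
  rewrite addr0 linear_sum (bigD1 (Ordinal vb')) //= [X in _ + X]big1 => [|t].
    by rewrite cfE !subnK // !eqxx mulr1 addr0.
  rewrite -val_eqE /= => vt; rewrite cfE [(v == _)%N](_ : _ = false) ?andbF ?mulr0 //.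
  by apply: contraNF vt => /eqP->; rewrite addnK.
rewrite -val_eqE /= => us; rewrite linear_sum big1 // => t _.
rewrite cfE [(u == _)%N](_ : _ = false) ?mulr0 //.
by apply: contraNF us => /eqP->; rewrite addnK.
Qed.

Lemma linear_kdiff N i (F : nat -> nat -> A -> A) : (forall s s', linear (F s s')) ->
  linear (fun z => kdiff N i (fun s s' => F s s' z) 0 0).
Proof.
move=> Fl c z z'; rewrite /kdiff; case: ifP => _; last first.
  by rewrite !Fl scalerBr opprD addrACA.
by rewrite scaler_sumr -big_split; apply: eq_bigr => t _; rewrite Fl.
Qed.

Lemma cf_kDx i j m u v : (u < a)%N -> (v < b)%N ->
  cf u v (phi (kDx i j *: m)) = if (kstep a i <= u)%N
    then cobdx_coef q a b i j v * cf (u - kstep a i)%N v (phi m) else 0.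
Proof.
move=> ua vb; rewrite phi_kDx.
have Fl s s' : linear (fun z : A => q ^+ (s' * kdeg b j) *: (x ^+ s * z * x ^+ s')).
  move=> c z z'; rewrite mulrDr mulrDl scalerDr -scalerAr -scalerAl.
  by rewrite [in LHS]scalerA mulrC -scalerA.
pose Tf (z : A) := kdiff a i (fun s s' => q ^+ (s' * kdeg b j) *:
  (x ^+ s * z * x ^+ s')) 0 0.
have Tl : linear Tf := linear_kdiff a i Fl.
pose T : {linear A -> A} := HB.pack Tf (GRing.isLinear.Build k A A *:%R Tf Tl).
rewrite -[kdiff _ _ _ _ _]/(T (phi m)) (mb_span mbA (phi m)) linear_sum.
rewrite (eq_bigr (fun s : 'I_a => \sum_(t < b)
    (cf s t (phi m) * cobdx_coef q a b i j t) *: (y ^+ (t + 0) * x ^+ (s + kstep a i)))).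
  rewrite (@cf_sum _ 0 _ _ (fun s t => cf s t (phi m) * cobdx_coef q a b i j t)) //.
  by rewrite andbT subn0 mulrC -(mb_span mbA).
move=> s _; rewrite linear_sum; apply: eq_bigr => t _.
by rewrite linearZ_LR [T _]kdiff_mon_x scalerA addn0.
Qed.

Lemma cf_kDy i j m u v : (u < a)%N -> (v < b)%N ->
  cf u v (phi (kDy i j *: m)) = if (kstep b j <= v)%N
    then cobdy_coef q a b i j u * cf u (v - kstep b j)%N (phi m) else 0.
Proof.
move=> ua vb; rewrite phi_kDy.
have Fl t t' : linear (fun z : A => q ^+ (kdeg a i * t) *: (y ^+ t * z * y ^+ t')).
  move=> c z z'; rewrite mulrDr mulrDl scalerDr -scalerAr -scalerAl.
  by rewrite [in LHS]scalerA mulrC -scalerA.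
pose Tf (z : A) := kdiff b j (fun t t' => q ^+ (kdeg a i * t) *:
  (y ^+ t * z * y ^+ t')) 0 0.
have Tl : linear Tf := linear_kdiff b j Fl.
pose T : {linear A -> A} := HB.pack Tf (GRing.isLinear.Build k A A *:%R Tf Tl).
rewrite -[kdiff _ _ _ _ _]/(T (phi m)) (mb_span mbA (phi m)) linear_sum.
rewrite (eq_bigr (fun s : 'I_a => \sum_(t < b)
    (cf s t (phi m) * cobdy_coef q a b i j s) *: (y ^+ (t + kstep b j) * x ^+ (s + 0)))).
  rewrite (@cf_sum 0 _ _ _ (fun s t => cf s t (phi m) * cobdy_coef q a b i j s)) //.
  by rewrite subn0 mulrC -(mb_span mbA).
move=> s _; rewrite linear_sum; apply: eq_bigr => t _.
by rewrite linearZ_LR [T _]kdiff_mon_y scalerA addn0.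
Qed.

(** * Cochains, their harmonic coefficients and the dimension of Ext *)

Hypothesis qX1 : forall m, (0 < m)%N -> q ^+ m != 1.

Lemma kres_diff_gen n i j : (i + j)%N = n.+1 ->
  res_diff kres n (diag_gen E n.+1 i j) =
    (if i is i'.+1 then kDx i' j *: diag_gen E n i' j else 0) +
    (if j is j'.+1 then ((-1) ^+ i *: kDy i j') *: diag_gen E n i j' else 0).
Proof.
move=> ij; apply: diagP => s t st.
have atZ D g : diag_at (D *: g) s t = D * diag_at (g : diagmod E n) s t :> E.
  by rewrite -[D *: g]addr0 diag_at_linear diag_at0 addr0.
have atD (g h : diagmod E n) : diag_at (g + h) s t = diag_at g s t + diag_at h s t.
  by rewrite -[g]scale1r diag_at_linear mul1r scale1r.
rewrite atD [LHS]diag_ofK // /tot_diff; congr (_ + _).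
  rewrite diag_ofK ?addSn ?st // /= /kdx /env_mulr.
  case: i ij => [|i] ij; first by rewrite mul0r diag_at0.
  rewrite atZ diag_ofK // eqSS; case: andP => [[/eqP-> /eqP->]|_].
    by rewrite mul1r mulr1.
  by rewrite mul0r mulr0.
rewrite diag_ofK ?addnS ?st // /= /kdy /env_mulr.
case: j ij => [|j] ij; first by rewrite andbF mul0r diag_at0 scaler0.
rewrite atZ diag_ofK // eqSS; case: andP => [[/eqP-> /eqP->]|_].
  by rewrite mul1r mulr1.
by rewrite mul0r mulr0 scaler0.
Qed.

Lemma phiZ c D m : phi ((c *: D) *: m) = c *: phi (D *: m).
Proof. exact: (linearZ_LR (act_on m)). Qed.

(** The value zero off the diagonal i + j = n makes a cochain of degree n an array to which [cobd]
    applies. *)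
Definition cochain_coef n (f : hom (diagmod E n) M) i j u v : k :=
  if (i + j == n)%N then cf u v (phi (hom_fun f (diag_gen E n i j))) else 0.

Lemma cochain_coef_precomp n (f : hom (diagmod E n) M) i j u v :
    (i + j)%N = n.+1 -> (u < a)%N -> (v < b)%N ->
  cochain_coef (precomp (res_diff kres n) f : hom (diagmod E n.+1) M) i j u v
    = cobd q a b (cochain_coef f) i j u v.
Proof.
move=> ij ua vb; rewrite /cochain_coef ij eqxx.
rewrite [hom_fun _ _](_ : _ = hom_fun f (res_diff kres n (diag_gen E n.+1 i j))) //.
rewrite kres_diff_gen // /cobd linearD raddfD linearD; congr (_ + _).
  case: i ij => [|i] ij; first by rewrite !linear0 raddf0 linear0.
  rewrite linearZ /= cf_kDx // /prev_term; case: ifP => // _.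
  by rewrite (_ : i + j == n)%N //; apply/eqP; lia.
case: j ij => [|j] ij; first by rewrite !linear0 raddf0 linear0 mulr0.
rewrite linearZ /= phiZ linearZ /= cf_kDy // /prev_term.
by case: ifP => // _; rewrite (_ : i + j == n)%N //; apply/eqP; lia.
Qed.

Lemma cochain_coef_linear n i j u v :
  linear (fun f : hom (diagmod E n) M => cochain_coef f i j u v : k^o).
Proof.
move=> c f g; rewrite /cochain_coef; case: ifP => _; last by rewrite scaler0 addr0.
rewrite [hom_fun _ _](_ : _ = (c%:A : E) *: hom_fun f (diag_gen E n i j)
  + hom_fun g (diag_gen E n i j)) //.
by rewrite raddfD phiZ scale1r linearP.
Qed.

Lemma cochain_coef_inj n (f g : hom (diagmod E n) M) :
    (forall i j u v, (i + j)%N = n -> (u < a)%N -> (v < b)%N ->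
      cochain_coef f i j u v = cochain_coef g i j u v) ->
  f = g.
Proof.
move=> fg; apply: homP => z; rewrite [LHS]diag_linearE [RHS]diag_linearE.
apply: eq_bigr => i _; congr (_ *: _); apply: (can_inj phiK).
rewrite [LHS](mb_span mbA) [RHS](mb_span mbA).
apply: eq_bigr => u _; apply: eq_bigr => v _; congr (_ *: _).
have e : (i + (n - i))%N = n by have := ltn_ord i; lia.
by have := fg i (n - i)%N u v e (ltn_ord u) (ltn_ord v); rewrite /cochain_coef e eqxx.
Qed.

Definition hom_of_coef n (G : nat -> nat -> nat -> nat -> k) : hom (diagmod E n) M :=
  to_hom (diag_ext (fun i j => psi (\sum_(u < a) \sum_(v < b)
    G i j u v *: (y ^+ v * x ^+ u))) : {linear diagmod E n -> M}).

Lemma cochain_coef_of n G i j u v : (i + j)%N = n -> (u < a)%N -> (v < b)%N ->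
  cochain_coef (hom_of_coef n G) i j u v = G i j u v.
Proof.
move=> ij ua vb; rewrite /cochain_coef ij eqxx /hom_of_coef.
rewrite [hom_fun _ _](diag_ext_gen _ ij) psiK.
have := cf_sum 0 0 (G i j) ua vb; rewrite !subn0 /= => <-.
congr (cf u v _).
by apply: eq_bigr => s _; apply: eq_bigr => t _; rewrite !addn0.
Qed.

Lemma eq_cobd g g' i j u v : (u < a)%N -> (v < b)%N ->
    (forall i j u v, (u < a)%N -> (v < b)%N -> g i j u v = g' i j u v) ->
  cobd q a b g i j u v = cobd q a b g' i j u v.
Proof.
move=> ua vb gg; rewrite /cobd /prev_term; congr (_ + _ * _).
  by case: i => // i; case: ifP => // _; rewrite gg //; lia.
by case: j => // j; case: ifP => // _; rewrite gg //; lia.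
Qed.

Lemma cocycle_coefP n (f : hom (diagmod E n) M) :
  f \in cocycles M kres n <-> (forall i j u v, (u < a)%N -> (v < b)%N ->
     cobd q a b (cochain_coef f) i j u v = 0).
Proof.
have kc0 l i j u v : cochain_coef (0 : hom (diagmod E l) M) i j u v = 0.
  by rewrite /cochain_coef raddf0 linear0 if_same.
split=> [/eqP f0 i j u v ua vb|f0].
  have [ij|ij] := eqVneq (i + j)%N n.+1.
    by rewrite -cochain_coef_precomp // f0 kc0.
  have z i' j' u' v' : (i' + j')%N != n -> cochain_coef f i' j' u' v' = 0.
    by rewrite /cochain_coef => /negbTE ->.
  rewrite /cobd [X in X + _](_ : _ = 0).
    rewrite [X in _ * X](_ : _ = 0) ?mulr0 ?addr0 //.
    by case: j ij => [|j] ij //=; case: ifP => // _; rewrite z ?mulr0 //; lia.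
  by case: i ij => [|i] ij //=; case: ifP => // _; rewrite z ?mulr0 //; lia.
apply/eqP.
apply: (@cochain_coef_inj n.+1 (precomp (res_diff kres n) f : hom (diagmod E n.+1) M) 0).
move=> i j u v ij ua vb.
by rewrite cochain_coef_precomp // f0 // kc0.
Qed.

Definition harmonic_seq n : seq (nat * nat * nat * nat) := [seq p <-
  [:: (0, 0, 0, 0); (0, 0, a.-1, b.-1); (1, 0, 1, 0); (0, 1, 0, 1); (1, 1, 1, 1)]
  | p.1.1.1 + p.1.1.2 == n]%N.

Lemma mem_harmonic_seq n i j u v :
  ((i, j, u, v) \in harmonic_seq n) = (i + j == n)%N && harmonic a b (i, j, u, v).
Proof. by rewrite mem_filter. Qed.

Lemma harmonic_seq_uniq n : uniq (harmonic_seq n).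
Proof.
by apply: filter_uniq; rewrite /= !inE !xpair_eqE /=; lia.
Qed.

Lemma harmonic_box i j u v : harmonic a b (i, j, u, v) -> (u < a)%N && (v < b)%N.
Proof.
rewrite /harmonic !inE !xpair_eqE => /or4P[||| /orP[]];
  move=> /andP[/andP[_ /eqP->] /eqP->]; lia.
Qed.

Definition harmonic_ev n (f : hom (diagmod E n) M) : 'rV[k]_(size (harmonic_seq n)) :=
  \row_t (let: (i, j, u, v) := nth (0, 0, 0, 0)%N (harmonic_seq n) t in
          cochain_coef f i j u v).

Lemma harmonic_ev_linear n : linear (@harmonic_ev n).
Proof.
move=> c f g; apply/rowP => t; rewrite !mxE.
case: (nth _ _ _) => [[[i j] u] v].
exact: (cochain_coef_linear i j u v c f g).
Qed.

Lemma harmonic_ev_eq0 n (f : hom (diagmod E n) M) :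
  harmonic_ev f = 0 <->
  (forall i j u v, harmonic a b (i, j, u, v) -> cochain_coef f i j u v = 0).
Proof.
split=> [f0 i j u v H|f0].
  have [ij|/negbTE ij] := eqVneq (i + j)%N n; last by rewrite /cochain_coef ij.
  have pin : (i, j, u, v) \in harmonic_seq n by rewrite mem_harmonic_seq ij eqxx.
  have lt : (index (i, j, u, v) (harmonic_seq n) < size (harmonic_seq n))%N.
    by rewrite index_mem.
  by have /rowP/(_ (Ordinal lt)) := f0; rewrite !mxE /= nth_index.
apply/rowP => t; rewrite !mxE.
have := mem_nth (0, 0, 0, 0)%N (ltn_ord t).
case: (nth _ _ _) => [[[i j] u] v]; rewrite mem_harmonic_seq => /andP[_ H].
exact: f0.
Qed.

Lemma coboundary_harmonicP n (f : hom (diagmod E n) M) : f \in cocycles M kres n ->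
  is_coboundary (P := kres) f <-> harmonic_ev f = 0.
Proof.
move=> /cocycle_coefP fZ; rewrite harmonic_ev_eq0; split=> [fB i j u v H|f0].
  have [ij|/negbTE ij] := eqVneq (i + j)%N n; last by rewrite /cochain_coef ij.
  have /andP[ua vb] := harmonic_box H.
  case: n f ij fB {fZ} => [|n] f ij /= => [->|[g ->]].
    by rewrite /cochain_coef raddf0 linear0 if_same.
  rewrite cochain_coef_precomp //.
  exact: cobd_harmonic.
have e := cobd_htpyP a2 b2 q0 qX1 fZ f0.
case: n f fZ f0 e => [|n] f fZ f0 e /=.
  (* In degree 0 there is no incoming map, so [cobd_htpyP] shows that all coefficients vanish. *)
  apply: cochain_coef_inj => i j u v ij ua vb.
  rewrite -e // /cochain_coef raddf0 linear0 if_same.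
  have [-> ->] : i = 0%N /\ j = 0%N by lia.
  by rewrite /cobd /= mulr0 addr0.
exists (hom_of_coef n (cobd_htpy q a b (cochain_coef f))).
apply: cochain_coef_inj => i j u v ij ua vb.
rewrite cochain_coef_precomp // -e //.
apply: eq_cobd => // {ij}i {}j {ua}u {vb}v ua vb.
(* Off the diagonal both arrays vanish, since the homotopy reads the cochain one diagonal
   further. *)
have [ij|ij] := eqVneq (i + j)%N n; first by rewrite cochain_coef_of.
rewrite /cochain_coef (negbTE ij) /cobd_htpy addSn addnS eqSS (negbTE ij) !mulr0.
by rewrite !if_same.
Qed.

Lemma harmonic_ev_surj n r : exists2 f : hom (diagmod E n) M,
  f \in cocycles M kres n & harmonic_ev f = r.
Proof.
(* The list has no duplicates, so the sum has one term, the coordinate of [r] at that monomial. *)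
pose G i j u v : k := if (i, j, u, v) \in harmonic_seq n then
  \sum_(t < size (harmonic_seq n)
        | nth (0, 0, 0, 0)%N (harmonic_seq n) t == (i, j, u, v)) r 0 t
  else 0.
have GE i j u v : (i + j)%N = n -> (u < a)%N -> (v < b)%N ->
    cochain_coef (hom_of_coef n G) i j u v = G i j u v.
  by move=> *; exact: cochain_coef_of.
have G0 i j u v : ~~ harmonic a b (i, j, u, v) -> G i j u v = 0.
  by rewrite /G mem_harmonic_seq => /negbTE ->; rewrite andbF.
exists (hom_of_coef n G).
  apply/cocycle_coefP => i j u v ua vb.
  rewrite (@eq_cobd _ G i j u v ua vb); first exact: cobd_harmonic_supp.
  move=> {i j u ua v vb} i j u v ua vb.
  have [ij|ij] := eqVneq (i + j)%N n; first exact: GE.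
  by rewrite /cochain_coef /G mem_harmonic_seq (negbTE ij).
apply/rowP => t; rewrite !mxE.
have := mem_nth (0, 0, 0, 0)%N (ltn_ord t).
case E1: (nth _ _ _) => [[[i j] u] v] pin.
have := pin; rewrite mem_harmonic_seq => /andP[/eqP ij /harmonic_box/andP[ua vb]].
rewrite GE // /G pin (bigD1 t) ?E1 //= big1 ?addr0 // => t' /andP[/eqP e ne].
move: ne; rewrite -val_eqE /= -(nth_uniq (0, 0, 0, 0)%N _ _ (harmonic_seq_uniq n)) //.
by rewrite e E1 eqxx.
Qed.

Theorem has_dim_Ext_harmonic (P : proj_resolution M) n :
  has_dim (Ext M P n) (size (harmonic_seq n)).
Proof.
pose ev : {linear hom (res_obj kres n) M -> 'rV[k]_(size (harmonic_seq n))} :=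
  HB.pack (@harmonic_ev n) (GRing.isLinear.Build k (hom (diagmod E n) M) _ *:%R
    (@harmonic_ev n) (@harmonic_ev_linear n)).
apply: (@has_dim_Ext k E M M P kres n _ ev); first exact: harmonic_ev_surj.
exact: coboundary_harmonicP.
Qed.

End Koszul.

(** * Specialisation to the enveloping algebra and Hochschild cohomology *)

Lemma env_enveloping (k : comNzRingType) (A : algType k) :
  enveloping (@env_tens k A : A -> A -> env A).
Proof.
split.
- exact: tens_bilin.
- exact: env_mulE.
- by [].
- move=> V f fb.
  exists (HB.pack (tensor_lift f) (GRing.isLinear.Build k (env A) V *:%R
    (tensor_lift f) (tensor_lift_linear fb)) : {linear env A -> V}).
  exact: tensor_liftE.
- move=> V f g fg; apply: tensor_ext; [exact: linearP|exact: linearP|exact: fg].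
Qed.

(** [bimod A] is a module over [env A] and [A] one over k, so the identity of carriers is declared
    as an additive map. *)
Definition bimod_carrier (k : comNzRingType) (A : algType k) (m : bimod A) : A :=
  m.

HB.instance Definition _ (k : comNzRingType) (A : algType k) :=
  GRing.isZmodMorphism.Build (bimod A) A (@bimod_carrier k A) (fun _ _ => erefl).

Theorem has_dim_HH (k : fieldType) (q : k) (a b : nat) (A : algType k) (x y : A)
    (cf : nat -> nat -> {linear A -> k^o}) (P : proj_resolution (bimod A)) n :
    (2 <= a)%N -> (2 <= b)%N -> q != 0 ->
    (forall m, (0 < m)%N -> q ^+ m != 1) ->
    monomial_basis q a b x y cf ->
  has_dim (HH P n) (size (harmonic_seq a b n)).
Proof.
move=> a2 b2 q0 qX1 mbA.
have idK : cancel (@bimod_carrier k A) (@id A : A -> bimod A) by [].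
have idK' : cancel (@id A : A -> bimod A) (@bimod_carrier k A) by [].
exact: (has_dim_Ext_harmonic mbA (env_enveloping A) q0 a2 b2 idK idK'
  (@env_scaleE k A) qX1).
Qed.

Theorem theorem3p2 (k : fieldType) (q : k) (a b : nat)
    (ha : (2 <= a)%N) (hb : (2 <= b)%N) (hq0 : q != 0)
    (hq : forall m : nat, (0 < m)%N -> ~~ m.-unity_root q)
    (P : proj_resolution (bimod (qci q ha hb))) :
  (forall n : nat,
     has_dim (HH P n) (match n with 0 => 2 | 1 => 2 | 2 => 1 | _ => 0 end)%N)
  /\ (exists n0 : nat, forall n : nat, (n0 <= n)%N ->
        forall x : HH P n, x = 0).
Proof.
have qX1 m : (0 < m)%N -> q ^+ m != 1.
  by move=> /hq; rewrite unity_rootE.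
have dimE n : has_dim (HH P n)
    (match n with 0 => 2 | 1 => 2 | 2 => 1 | _ => 0 end)%N.
  have := has_dim_HH P n ha hb hq0 qX1 (qci_monomial_basis q ha hb).
  (* The lengths of the harmonic lists compute to 2, 2, 1 and then 0. *)
  by case: n => [|[|[|n]]].
split=> //; exists 3; move=> [|[|[|n]]] // _ z.
(* In dimension 0 every vector is the empty sum. *)
have [e /(_ z)[c [-> _]]] := dimE n.+3.
by rewrite big_ord0.
Qed.
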